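(* Let $H$ be a coFrobenius Hopf algebra over a field $k$ and $A$ a right $H$-comodule algebra. For each object $M$ of $\mathrm{LMod}_A(\mathcal{M}^H)$ there is a short exact sequence in $\mathrm{LMod}_A(\mathcal{M}^H)$ $$0\to M\to aM\to \bar{p}M\to 0$$ which is split exact as a sequence of left $A$-modules, where $\bar{p}M$, and also $p(M)=\Sigma^{-1}(\bar{p}M)$, is cofibrant, and $aM$ is injective as a right $H$-comodule. The construction of the short exact sequence is functorial in $M$.
   Context: $\otimes=\otimes_k$. $H$ is coFrobenius if there is a nonzero left integral $\Lambda:H\to k$, i.e. a nonzero $k$-linear map with $h_{(1)}\Lambda(h_{(2)})=\Lambda(h)1$ for all $h\in H$; fix one and put $\Lambda'=\Lambda\circ S$, where $S$ is the antipode of $H$, so that $\Lambda':H\to k$ is a map of right $H$-comodules ($H$ with coaction $\Delta$, $k$ with trivial coaction). $\mathcal{M}^H$ is the category of right $H$-comodules; tensor products carry the diagonal coaction. A right $H$-comodule algebra is a $k$-algebra with a right $H$-comodule structure for which multiplication and unit are $H$-colinear. $\mathrm{LMod}_A(\mathcal{M}^H)$ is the category of right $H$-comodules $M$ with a left $A$-module structure whose action $A\otimes M\to M$ is $H$-colinear; its morphisms are the $A$-linear $H$-colinear maps, forming the $k$-vector spaces $\mathrm{Hom}_A^H(M,N)$. For $N\in\mathrm{LMod}_A(\mathcal{M}^H)$, $N\otimes H$ is an object of $\mathrm{LMod}_A(\mathcal{M}^H)$ with the diagonal coaction and with $A$ acting on the factor $N$; $\Sigma^{-1}(N)$ is the kernel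 of $\mathrm{id}\otimes\Lambda':N\otimes H\to N\otimes k\cong N$. A morphism $L\to N$ in $\mathrm{LMod}_A(\mathcal{M}^H)$ is a stable equivalence if it becomes an isomorphism in the category whose objects are right $H$-comodules and whose morphisms are $H$-colinear maps modulo those factoring through an injective right $H$-comodule. An object $P$ of $\mathrm{LMod}_A(\mathcal{M}^H)$ is cofibrant if for every surjective stable equivalence $L\to N$ in $\mathrm{LMod}_A(\mathcal{M}^H)$ the induced map $\mathrm{Hom}_A^H(P,L)\to\mathrm{Hom}_A^H(P,N)$ is surjective. *)

(* Defs.v *)
From HB Require Import structures.
From mathcomp Require Import all_boot all_order all_algebra.
From mathcomp Require Import boolp.

Set Implicit Arguments.
Unset Strict Implicit.
Unset Printing Implicit Defensive.

Import GRing.Theory.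
Local Open Scope quotient_scope.
Local Open Scope ring_scope.

(* Tensor product over k: formal sums of pure tensors, encoded as sequences of *)
(* pairs, modulo the congruence generated by bilinearity. The universal        *)
(* property is given by [tens_lin], [tliftE] and [tens_ext].                   *)
Section TensorRel.
Variables (k : fieldType) (V W : lmodType k).

Inductive tens_rel : seq (V * W) -> seq (V * W) -> Prop :=
| TensRefl s : tens_rel s s
| TensSym s t : tens_rel s t -> tens_rel t s
| TensTrans s t u : tens_rel s t -> tens_rel t u -> tens_rel s u
| TensCat s s' t t' :
    tens_rel s s' -> tens_rel t t' -> tens_rel (s ++ t) (s' ++ t')
| TensCatC s t : tens_rel (s ++ t) (t ++ s)
| TensZero w : tens_rel [:: (0, w)] [::]
| TensDl v v' w : tens_rel [:: (v + v', w)] [:: (v, w); (v', w)]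
| TensDr v w w' : tens_rel [:: (v, w + w')] [:: (v, w); (v, w')]
| TensZ (a : k) v w : tens_rel [:: (a *: v, w)] [:: (v, a *: w)].

Definition tens_relb : rel (seq (V * W)) := fun s t => `[< tens_rel s t >].

Fact tens_relb_refl : reflexive tens_relb.
Proof. by move=> s; apply/asboolP/TensRefl. Qed.

Fact tens_relb_sym : symmetric tens_relb.
Proof.
by move=> s t; apply/idP/idP => /asboolP h; apply/asboolP/TensSym.
Qed.

Fact tens_relb_trans : transitive tens_relb.
Proof.
by move=> t s u /asboolP h1 /asboolP h2; apply/asboolP/(TensTrans h1 h2).
Qed.

Canonical tens_equiv :=
  EquivRel tens_relb tens_relb_refl tens_relb_sym tens_relb_trans.

Definition tensor := {eq_quot tens_equiv}.

HB.instance Definition _ := Choice.on tensor.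

Definition tcls (s : seq (V * W)) : tensor := \pi_{eq_quot tens_equiv} s.

Lemma tclsP s t : tcls s = tcls t <-> tens_rel s t.
Proof.
split=> [/eqquotP/asboolP //|h].
by apply/eqquotP/asboolP.
Qed.

Definition trepr (x : tensor) : seq (V * W) := repr x.

Lemma treprK x : tcls (trepr x) = x.
Proof. exact: reprK. Qed.

Lemma trepr_cls s : tens_rel (trepr (tcls s)) s.
Proof. by apply/tclsP; rewrite treprK. Qed.

Definition tscaleseq (a : k) (s : seq (V * W)) := [seq (a *: p.1, p.2) | p <- s].

Lemma tens_scaleseq a s t :
  tens_rel s t -> tens_rel (tscaleseq a s) (tscaleseq a t).
Proof.
elim=> {s t} [s|s t _|s t u _ + _|s s' t t' _ + _|s t|w|v v' w|v w w'|b v w] /=.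
- exact: TensRefl.
- exact: TensSym.
- exact: TensTrans.
- by rewrite /tscaleseq !map_cat; apply: TensCat.
- by rewrite /tscaleseq !map_cat; apply: TensCatC.
- by rewrite /tscaleseq /= scaler0; apply: TensZero.
- by rewrite /tscaleseq /= scalerDr; apply: TensDl.
- by rewrite /tscaleseq /=; apply: TensDr.
- by rewrite /tscaleseq /= scalerA mulrC -scalerA; apply: TensZ.
Qed.

Definition tzero : tensor := tcls [::].
Definition tadd (x y : tensor) : tensor := tcls (trepr x ++ trepr y).
Definition tscale (a : k) (x : tensor) : tensor := tcls (tscaleseq a (trepr x)).
Definition topp (x : tensor) : tensor := tscale (-1) x.

Lemma tadd_cls s t : tadd (tcls s) (tcls t) = tcls (s ++ t).
Proof. by apply/tclsP/TensCat; apply: trepr_cls. Qed.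

Lemma tscale_cls a s : tscale a (tcls s) = tcls (tscaleseq a s).
Proof. by apply/tclsP/tens_scaleseq/trepr_cls. Qed.

Lemma tens_elim (P : tensor -> Prop) : (forall s, P (tcls s)) -> forall x, P x.
Proof. by move=> h x; rewrite -(treprK x). Qed.

Fact taddA : associative tadd.
Proof.
by elim/tens_elim=> s; elim/tens_elim=> t; elim/tens_elim=> u; rewrite !tadd_cls catA.
Qed.

Fact taddC : commutative tadd.
Proof.
elim/tens_elim=> s; elim/tens_elim=> t; rewrite !tadd_cls.
exact/tclsP/TensCatC.
Qed.

Fact tadd0 : left_id tzero tadd.
Proof. by elim/tens_elim=> s; rewrite tadd_cls. Qed.

Fact tscaleDr a : {morph tscale a : x y / tadd x y}.
Proof.
elim/tens_elim=> s; elim/tens_elim=> t.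
by rewrite tadd_cls !tscale_cls tadd_cls /tscaleseq map_cat.
Qed.

Fact tscale1 : left_id 1 tscale.
Proof.
elim/tens_elim=> s; rewrite tscale_cls; congr tcls.
by rewrite -[RHS]map_id; apply: eq_map => -[v w] /=; rewrite scale1r.
Qed.

Fact tscaleA a b x : tscale a (tscale b x) = tscale (a * b) x.
Proof.
elim/tens_elim: x => s; rewrite !tscale_cls; congr tcls.
by rewrite /tscaleseq -map_comp; apply: eq_map => -[v w] /=; rewrite scalerA.
Qed.

Fact tscaleDl a b x : tscale (a + b) x = tadd (tscale a x) (tscale b x).
Proof.
elim/tens_elim: x => s; rewrite !tscale_cls tadd_cls; apply/tclsP.
elim: s => [|[v w] s ih] /=; first exact: TensRefl.
rewrite scalerDl -cat1s.
apply: (TensTrans (TensCat (TensDl _ _ _) ih)).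
rewrite -/(tscaleseq a s) -/(tscaleseq b s).
set S := tscaleseq a s; set T := tscaleseq b s.
rewrite [X in tens_rel X]
  (_ : _ = [:: (a *: v, w)] ++ ([:: (b *: v, w)] ++ S) ++ T) //.
rewrite [X in tens_rel _ X]
  (_ : _ = [:: (a *: v, w)] ++ (S ++ [:: (b *: v, w)]) ++ T); last by rewrite -catA.
apply: TensCat; first exact: TensRefl.
apply: TensCat; last exact: TensRefl.
exact: TensCatC.
Qed.

Fact tscale0 x : tscale 0 x = tzero.
Proof.
elim/tens_elim: x => s; rewrite tscale_cls; apply/tclsP.
elim: s => [|[v w] s ih] /=; first exact: TensRefl.
rewrite scale0r -cat1s -[X in tens_rel _ X]cat0s.
by apply: TensCat => //; apply: TensZero.
Qed.

Fact taddN : left_inverse tzero topp tadd.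
Proof. by move=> x; rewrite /topp -{2}[x]tscale1 -tscaleDl addNr tscale0. Qed.

HB.instance Definition _ :=
  GRing.isZmodule.Build tensor taddA taddC tadd0 taddN.
HB.instance Definition _ :=
  GRing.Zmodule_isLmodule.Build k tensor tscaleA tscale1 tscaleDr
    (fun x a b => tscaleDl a b x).

Definition tens (v : V) (w : W) : tensor := tcls [:: (v, w)].

Fact tens_lin : bilinear_for *:%R *:%R tens.
Proof.
split=> [w a v v'|v a w w'].
  rewrite [LHS](_ : _ = tcls ([:: (a *: v, w)] ++ [:: (v', w)])).
    by rewrite -tadd_cls; congr (tadd _ _); rewrite [RHS]tscale_cls.
  exact/tclsP/TensDl.
rewrite [LHS](_ : _ = tcls ([:: (v, a *: w)] ++ [:: (v, w')])).
  rewrite -tadd_cls; congr (tadd _ _); rewrite [RHS]tscale_cls.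
  exact/tclsP/TensSym/TensZ.
exact/tclsP/TensDr.
Qed.

HB.instance Definition _ :=
  bilinear_isBilinear.Build k V W tensor *:%R *:%R tens tens_lin.

End TensorRel.

Arguments tens {k V W}.

Notation "V ⊗ W" := (tensor V W) (at level 40, left associativity) : type_scope.
Notation "V ⊗ W" := (tensor V W) : ring_scope.
Notation "v ⊗ₜ w" := (tens v w)
  (at level 40, left associativity) : ring_scope.

Section TensorTheory.
Variable k : fieldType.
Implicit Types U V W X Y Z : lmodType k.

Lemma tensDl V W (v v' : V) (w : W) : (v + v') ⊗ₜ w = v ⊗ₜ w + v' ⊗ₜ w.
Proof. exact: (linearDl (@tens k V W)). Qed.
Lemma tensDr V W (v : V) (w w' : W) : v ⊗ₜ (w + w') = v ⊗ₜ w + v ⊗ₜ w'.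
Proof. exact: (linearDr (@tens k V W)). Qed.
Lemma tensZl V W a (v : V) (w : W) : (a *: v) ⊗ₜ w = a *: (v ⊗ₜ w).
Proof. exact: (linearZl_LR (@tens k V W)). Qed.
Lemma tensZr V W a (v : V) (w : W) : v ⊗ₜ (a *: w) = a *: (v ⊗ₜ w).
Proof. exact: (linearZr_LR (@tens k V W)). Qed.

Lemma tensBl V W (v v' : V) (w : W) : (v - v') ⊗ₜ w = v ⊗ₜ w - v' ⊗ₜ w.
Proof. exact: (linearBl (@tens k V W)). Qed.

Lemma tens_ind V W (P : V ⊗ W -> Prop) :
    (forall x y, P x -> P y -> P (x + y)) ->
    (forall v w, P (v ⊗ₜ w)) ->
  forall x, P x.
Proof.
move=> hD hT; elim/tens_elim => s.
have P0 : P 0.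
  suff <- : (0 : V) ⊗ₜ (0 : W) = 0 by [].
  by have := tensZl 0 (0 : V) (0 : W); rewrite !scale0r.
elim: s => [//|[v w] s ih].
by rewrite -cat1s -tadd_cls; exact: hD (hT v w) ih.
Qed.

Definition tlift V W U (f : V -> W -> U) (x : V ⊗ W) : U :=
  \sum_(p <- trepr x) f p.1 p.2.

Section Lift.
Variables (V W U : lmodType k) (f : {bilinear V -> W -> U}).

Lemma tlift_rel s t : tens_rel s t ->
  \sum_(p <- s) f p.1 p.2 = \sum_(p <- t) f p.1 p.2.
Proof.
elim=> {s t} [s|s t _|s t u _ + _|s s' t t' _ + _|s t|w|v v' w|v w w'|b v w] /=.
- by [].
- by move->.
- by move=> -> ->.
- by rewrite !big_cat /= => -> ->.
- by rewrite !big_cat /= addrC.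
- by rewrite big_seq1 big_nil linear0l.
- by rewrite !big_cons !big_nil !addr0 linearDl.
- by rewrite !big_cons !big_nil !addr0 linearDr.
- by rewrite !big_seq1 linearZl_LR linearZr_LR.
Qed.

Lemma tlift_cls s : tlift f (tcls s) = \sum_(p <- s) f p.1 p.2.
Proof. exact/tlift_rel/trepr_cls. Qed.

Fact tlift_linear : linear (tlift f).
Proof.
move=> a; elim/tens_elim => s; elim/tens_elim => t.
rewrite [X in tlift f X](_ : _ = tcls (tscaleseq a s ++ t)); last first.
  by rewrite -tadd_cls; congr (tadd _ _); rewrite -tscale_cls.
rewrite !tlift_cls big_cat /=; congr (_ + _).
rewrite big_map scaler_sumr; apply: eq_bigr => p _ /=.
by rewrite linearZl_LR.
Qed.

HB.instance Definition _ :=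
  GRing.isLinear.Build k (V ⊗ W) U *:%R (tlift f) tlift_linear.

Lemma tliftE v w : tlift f (v ⊗ₜ w) = f v w.
Proof. by rewrite tlift_cls big_seq1. Qed.

End Lift.

Lemma tens_ext V W U (f g : {linear V ⊗ W -> U}) :
  (forall v w, f (v ⊗ₜ w) = g (v ⊗ₜ w)) -> f =1 g.
Proof.
move=> h; elim/tens_ind => // x y ex ey.
by rewrite !linearD ex ey.
Qed.

Lemma tliftP V W U (f g : V -> W -> U) a (x : V ⊗ W) :
  tlift (fun v w => a *: f v w + g v w) x = a *: tlift f x + tlift g x.
Proof. by rewrite /tlift big_split /= scaler_sumr. Qed.

Section Map.
Variables (V V' W W' : lmodType k) (f : {linear V -> V'}) (g : {linear W -> W'}).

Definition tmap_fun (v : V) (w : W) : V' ⊗ W' := f v ⊗ₜ g w.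

Fact tmap_fun_lin : bilinear_for *:%R *:%R tmap_fun.
Proof.
split=> [w a v v'|v a w w']; rewrite /tmap_fun linearP.
- by rewrite tensDl tensZl.
- by rewrite tensDr tensZr.
Qed.

HB.instance Definition _ :=
  bilinear_isBilinear.Build k V W (V' ⊗ W') *:%R *:%R tmap_fun tmap_fun_lin.

Definition tmap : {linear V ⊗ W -> V' ⊗ W'} := tlift tmap_fun.

Lemma tmapE v w : tmap (v ⊗ₜ w) = f v ⊗ₜ g w.
Proof. exact: tliftE. Qed.

End Map.

Lemma tmap_id V W (x : V ⊗ W) : tmap idfun idfun x = x.
Proof.
elim/tens_ind: x => [x y hx hy|v w]; last by rewrite tmapE.
by rewrite linearD hx hy.
Qed.

Lemma eq_tmap V V' W W' (f f' : {linear V -> V'}) (g g' : {linear W -> W'}) :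
  f =1 f' -> g =1 g' -> tmap f g =1 tmap f' g'.
Proof. by move=> ef eg; apply: tens_ext => v w; rewrite !tmapE ef eg. Qed.

Lemma tmap_comp V V' V'' W W' W'' (f : {linear V -> V'}) (f' : {linear V' -> V''})
    (g : {linear W -> W'}) (g' : {linear W' -> W''}) (x : V ⊗ W) :
  tmap (f' \o f) (g' \o g) x = tmap f' g' (tmap f g x).
Proof.
elim/tens_ind: x => [x y hx hy|v w]; last by rewrite !tmapE.
by rewrite !linearD hx hy.
Qed.

(* [tens2 b1 b2 (x ⊗ₜ x') (y ⊗ₜ y') = b1 x y ⊗ₜ b2 x' y'] *)
Section Tens2.
Variables (X Y Z X' Y' Z' : lmodType k).
Variables (b1 : {bilinear X -> Y -> Z}) (b2 : {bilinear X' -> Y' -> Z'}).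

Definition tens2_in (x : X) (x' : X') (y : Y) (y' : Y') : Z ⊗ Z' :=
  b1 x y ⊗ₜ b2 x' y'.

Fact tens2_in_lin x x' : bilinear_for *:%R *:%R (tens2_in x x').
Proof.
split=> [w a v v'|v a w w']; rewrite /tens2_in linearP.
- by rewrite tensDl tensZl.
- by rewrite tensDr tensZr.
Qed.

HB.instance Definition _ x x' :=
  bilinear_isBilinear.Build k Y Y' (Z ⊗ Z') *:%R *:%R (tens2_in x x')
    (tens2_in_lin x x').

Definition tens2_out (y : Y ⊗ Y') (x : X) (x' : X') : Z ⊗ Z' :=
  tlift (tens2_in x x') y.

Fact tens2_out_lin y : bilinear_for *:%R *:%R (tens2_out y).
Proof.
split=> [x' a x1 x2|x a x1 x2]; rewrite /tens2_out -tliftP;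
  apply: eq_bigr => p _; rewrite /tens2_in.
- by rewrite linearPl tensDl tensZl.
- by rewrite linearPl tensDr tensZr.
Qed.

HB.instance Definition _ y :=
  bilinear_isBilinear.Build k X X' (Z ⊗ Z') *:%R *:%R (tens2_out y)
    (tens2_out_lin y).

Definition tens2 (x : X ⊗ X') (y : Y ⊗ Y') : Z ⊗ Z' := tlift (tens2_out y) x.

Fact tens2_lin : bilinear_for *:%R *:%R tens2.
Proof.
split=> [y|x] a u v; rewrite /tens2; first exact: linearP.
rewrite -tliftP; apply: eq_bigr => p _.
by rewrite /tens2_out linearP.
Qed.

HB.instance Definition _ :=
  bilinear_isBilinear.Build k (X ⊗ X') (Y ⊗ Y') (Z ⊗ Z') *:%R *:%R tens2
    tens2_lin.

Lemma tens2Dl x1 x2 y : tens2 (x1 + x2) y = tens2 x1 y + tens2 x2 y.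
Proof. exact: (linearDl tens2). Qed.

Lemma tens2Dr x y1 y2 : tens2 x (y1 + y2) = tens2 x y1 + tens2 x y2.
Proof. exact: (linearDr tens2). Qed.

Lemma tens2Zl a x y : tens2 (a *: x) y = a *: tens2 x y.
Proof. exact: (linearZl_LR tens2). Qed.

Lemma tens2Zr a x y : tens2 x (a *: y) = a *: tens2 x y.
Proof. exact: (linearZr_LR tens2). Qed.

Lemma tens2E x x' y y' : tens2 (x ⊗ₜ x') (y ⊗ₜ y') = b1 x y ⊗ₜ b2 x' y'.
Proof. by rewrite /tens2 tliftE /= /tens2_out tliftE. Qed.

End Tens2.

Section Assoc.
Variables U V W : lmodType k.

Definition tassoc_in (w : W) (u : U) (v : V) : U ⊗ (V ⊗ W) := u ⊗ₜ (v ⊗ₜ w).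

Fact tassoc_in_lin w : bilinear_for *:%R *:%R (tassoc_in w).
Proof.
split=> [v a u u'|u a v v']; rewrite /tassoc_in.
- by rewrite tensDl tensZl.
- by rewrite tensDl tensZl tensDr tensZr.
Qed.

HB.instance Definition _ w :=
  bilinear_isBilinear.Build k U V (U ⊗ (V ⊗ W)) *:%R *:%R (tassoc_in w)
    (tassoc_in_lin w).

Definition tassoc_out (x : U ⊗ V) (w : W) : U ⊗ (V ⊗ W) :=
  tlift (tassoc_in w) x.

Fact tassoc_out_lin : bilinear_for *:%R *:%R tassoc_out.
Proof.
split=> [w|x] a y z; rewrite /tassoc_out; first exact: linearP.
rewrite -tliftP; apply: eq_bigr => p _.
by rewrite /tassoc_in tensDr tensZr tensDr tensZr.
Qed.

HB.instance Definition _ :=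
  bilinear_isBilinear.Build k (U ⊗ V) W (U ⊗ (V ⊗ W)) *:%R *:%R tassoc_out
    tassoc_out_lin.

Definition tassoc : {linear (U ⊗ V) ⊗ W -> U ⊗ (V ⊗ W)} := tlift tassoc_out.

Lemma tassocE u v w : tassoc ((u ⊗ₜ v) ⊗ₜ w) = u ⊗ₜ (v ⊗ₜ w).
Proof. by rewrite /tassoc /= tliftE /= /tassoc_out tliftE. Qed.

End Assoc.

(* the canonical isomorphisms V ⊗ k ≅ V and k ⊗ V ≅ V *)
Section Units.
Variable V : lmodType k.

Definition trunit_fun (v : V) (c : k^o) : V := (c : k) *: v.
Definition tlunit_fun (c : k^o) (v : V) : V := (c : k) *: v.

Fact trunit_fun_lin : bilinear_for *:%R *:%R trunit_fun.
Proof.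
split=> [c a v v'|v a c c']; rewrite /trunit_fun.
- by rewrite /= scalerDr !scalerA [in LHS]mulrC.
- by rewrite /= [LHS]scalerDl scalerA.
Qed.

HB.instance Definition _ :=
  bilinear_isBilinear.Build k V k^o V *:%R *:%R trunit_fun trunit_fun_lin.

Fact tlunit_fun_lin : bilinear_for *:%R *:%R tlunit_fun.
Proof.
have [h1 h2] := trunit_fun_lin.
by split=> [v a c c'|c a v v']; [exact: h2 | exact: h1].
Qed.

HB.instance Definition _ :=
  bilinear_isBilinear.Build k k^o V V *:%R *:%R tlunit_fun tlunit_fun_lin.

Definition trunit : {linear V ⊗ k^o -> V} := tlift trunit_fun.
Definition tlunit : {linear k^o ⊗ V -> V} := tlift tlunit_fun.

End Units.

(* id ⊗ f and f ⊗ id for a linear form f, followed by these isomorphisms *)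
Definition tcontr V W (f : {linear W -> k^o}) : {linear V ⊗ W -> V} :=
  @trunit V \o tmap idfun f.
Definition tcontl V W (f : {linear V -> k^o}) : {linear V ⊗ W -> W} :=
  @tlunit W \o tmap f idfun.

Lemma tcontrE V W (f : {linear W -> k^o}) (v : V) w :
  tcontr V f (v ⊗ₜ w) = (f w : k) *: v.
Proof. by rewrite /tcontr /= tmapE /trunit /= tliftE. Qed.

Lemma tcontlE V W (f : {linear V -> k^o}) v (w : W) :
  tcontl W f (v ⊗ₜ w) = (f v : k) *: w.
Proof. by rewrite /tcontl /= tmapE /tlunit /= tliftE. Qed.

Section Amul.
Variable A : algType k.

Definition amul (a b : A) : A := a * b.

Fact amul_lin : bilinear_for *:%R *:%R amul.
Proof.
split=> [b c a a'|a c b b']; rewrite /amul.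
- by rewrite /= mulrDl scalerAl.
- by rewrite /= mulrDr scalerAr.
Qed.

HB.instance Definition _ :=
  bilinear_isBilinear.Build k A A A *:%R *:%R amul amul_lin.

End Amul.

End TensorTheory.

Arguments tassoc {k U V W}.
Arguments tmap : simpl never.
Arguments trunit : simpl never.
Arguments tlunit : simpl never.
Arguments tcontr {k} V {W} f : simpl never.
Arguments tcontl {k V} W f : simpl never.
Arguments tlift : simpl never.
Arguments tens2 : simpl never.
Arguments tens {k V W} : simpl never.
Arguments amul {k A} : simpl never.

Section Kernel.
Variables (k : fieldType) (V W : lmodType k) (f : {linear V -> W}).

Definition ker_pred : {pred V} := fun x => f x == 0.

Fact ker_submod_closed : submod_closed ker_pred.
Proof.
split=> [|a x y /eqP fx /eqP fy]; apply/eqP; first exact: linear0.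
by rewrite linearP fx fy scaler0 addr0.
Qed.

HB.instance Definition _ :=
  GRing.isSubmodClosed.Build k V ker_pred ker_submod_closed.

Record ker := Ker { ker_val :> V; ker_valP : ker_val \in ker_pred }.

HB.instance Definition _ := [isSub for ker_val].
HB.instance Definition _ := [Choice of ker by <:].
HB.instance Definition _ := [SubChoice_isSubLmodule of ker by <:].

Definition ker_inc : {linear ker -> V} := \val.

Lemma ker_incP (x : ker) : f (ker_inc x) = 0.
Proof. by case: x => x /= /eqP. Qed.

Lemma ker_inc_inj : injective ker_inc.
Proof. exact: val_inj. Qed.

Section Retract.
Variables (g : {linear W -> V}) (fgf : forall x, f (g (f x)) = f x).

Fact ker_retr_subproof x : x - g (f x) \in ker_pred.
Proof. by apply/eqP; rewrite linearB fgf subrr. Qed.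

Definition ker_retr_fun x := Ker (ker_retr_subproof x).

Fact ker_retr_linear : linear ker_retr_fun.
Proof.
move=> a x y; apply: val_inj => /=.
by rewrite !linearP /= addrACA -scalerDr.
Qed.

HB.instance Definition _ :=
  GRing.isLinear.Build k V ker *:%R ker_retr_fun ker_retr_linear.

Definition ker_retr : {linear V -> ker} := ker_retr_fun.

Lemma ker_inc_retr x : ker_inc (ker_retr x) = x - g (f x).
Proof. by []. Qed.

Lemma ker_incK : cancel ker_inc ker_retr.
Proof.
by move=> x; apply: ker_inc_inj; rewrite ker_inc_retr ker_incP linear0 subr0.
Qed.

End Retract.
End Kernel.

Record hopfAlgType (k : fieldType) := HopfAlg {
  hopf_alg :> algType k;
  comul : {linear hopf_alg -> hopf_alg ⊗ hopf_alg};
  counit : {linear hopf_alg -> k^o};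
  antipode : {linear hopf_alg -> hopf_alg};
  comulA : forall h,
    tassoc (tmap comul idfun (comul h)) = tmap idfun comul (comul h);
  comul_counitr : forall h, tcontr _ counit (comul h) = h;
  comul_counitl : forall h, tcontl _ counit (comul h) = h;
  comul1 : comul 1 = 1 ⊗ₜ 1;
  comulM : forall g h, comul (g * h) = tens2 amul amul (comul g) (comul h);
  counit1 : counit 1 = 1;
  counitM : forall g h, counit (g * h) = (counit g : k) * counit h;
  antipodeL : forall h,
    tlift amul (tmap antipode idfun (comul h)) = (counit h : k)%:A;
  antipodeR : forall h,
    tlift amul (tmap idfun antipode (comul h)) = (counit h : k)%:A
}.

Section Comodules.
Variables (k : fieldType) (H : hopfAlgType k).

Record comodule := Comodule {
  cm_mod :> lmodType k;
  coact : {linear cm_mod -> cm_mod ⊗ H};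
  coactA : forall m,
    tassoc (tmap coact idfun (coact m)) = tmap idfun (comul H) (coact m);
  coact_counit : forall m, tcontr _ (counit H) (coact m) = m
}.

Definition colinear (M N : comodule) (f : {linear M -> N}) :=
  forall m, coact N (f m) = tmap f idfun (coact M m).

Record comod_hom (M N : comodule) := ComodHom {
  comod_hom_fun :> {linear M -> N};
  comod_hom_colinear : colinear comod_hom_fun
}.

(* diagonal coaction: m ⊗ n |-> m_(0) ⊗ n_(0) ⊗ m_(1) n_(1) *)
Section TensComod.
Variables M N : comodule.

Definition tens_coact_fun (m : M) (n : N) : (M ⊗ N) ⊗ H :=
  tens2 tens amul (coact M m) (coact N n).

Fact tens_coact_fun_lin : bilinear_for *:%R *:%R tens_coact_fun.
Proof.
split=> [n a m m'|m a n n']; rewrite /tens_coact_fun linearP.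
- exact: linearPl.
- exact: linearPr.
Qed.

HB.instance Definition _ :=
  bilinear_isBilinear.Build k M N ((M ⊗ N) ⊗ H) *:%R *:%R
    tens_coact_fun tens_coact_fun_lin.

Definition tens_coact : {linear M ⊗ N -> (M ⊗ N) ⊗ H} := tlift tens_coact_fun.

Lemma tens_coactE m n :
  tens_coact (m ⊗ₜ n) = tens2 tens amul (coact M m) (coact N n).
Proof. exact: tliftE. Qed.


Let tens_coactA_aux (h g : H) (u : M ⊗ H) (v : N ⊗ H) :
  tassoc (tens2 tens amul u v ⊗ₜ amul h g) =
  tens2 tens (tens2 amul amul) (tassoc (u ⊗ₜ h)) (tassoc (v ⊗ₜ g)).
Proof.
elim/tens_ind: u => [u1 u2 h1 h2|m a].
  by rewrite tens2Dl !tensDl !linearD h1 h2 tens2Dl.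
elim/tens_ind: v => [v1 v2 h1 h2|n b].
  by rewrite tens2Dr !tensDl !linearD h1 h2 tens2Dr.
by rewrite tens2E !tassocE tens2E /= tens2E.
Qed.

Let tens_coactA_l (x : M ⊗ H) (y : N ⊗ H) :
  tassoc (tmap tens_coact idfun (tens2 tens amul x y)) =
  tens2 tens (tens2 amul amul) (tassoc (tmap (coact M) idfun x))
    (tassoc (tmap (coact N) idfun y)).
Proof.
elim/tens_ind: x => [x1 x2 h1 h2|m a].
  by rewrite tens2Dl !linearD h1 h2 tens2Dl.
elim/tens_ind: y => [y1 y2 h1 h2|n b].
  by rewrite tens2Dr !linearD h1 h2 tens2Dr.
by rewrite tens2E !tmapE tens_coactE tens_coactA_aux.
Qed.

Let tens_coactA_r (x : M ⊗ H) (y : N ⊗ H) :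
  tmap idfun (comul H) (tens2 tens amul x y) =
  tens2 tens (tens2 amul amul) (tmap idfun (comul H) x)
    (tmap idfun (comul H) y).
Proof.
elim/tens_ind: x => [x1 x2 h1 h2|m a].
  by rewrite tens2Dl !linearD h1 h2 tens2Dl.
elim/tens_ind: y => [y1 y2 h1 h2|n b].
  by rewrite tens2Dr !linearD h1 h2 tens2Dr.
by rewrite tens2E !tmapE tens2E [comul H _]comulM.
Qed.

Let tens_coact_counit_aux (x : M ⊗ H) (y : N ⊗ H) :
  tcontr _ (counit H) (tens2 tens amul x y) =
  tcontr _ (counit H) x ⊗ₜ tcontr _ (counit H) y.
Proof.
elim/tens_ind: x => [x1 x2 h1 h2|m a].
  by rewrite tens2Dl !linearD h1 h2 tensDl.
elim/tens_ind: y => [y1 y2 h1 h2|n b].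
  by rewrite tens2Dr !linearD h1 h2 tensDr.
by rewrite tens2E !tcontrE tensZl tensZr scalerA [counit H _]counitM.
Qed.

Fact tens_coactA x :
  tassoc (tmap tens_coact idfun (tens_coact x)) =
  tmap idfun (comul H) (tens_coact x).
Proof.
elim/tens_ind: x => [x y hx hy|m n]; first by rewrite !linearD hx hy.
by rewrite tens_coactE tens_coactA_l tens_coactA_r !coactA.
Qed.

Fact tens_coact_counit x : tcontr _ (counit H) (tens_coact x) = x.
Proof.
elim/tens_ind: x => [x y hx hy|m n]; first by rewrite !linearD hx hy.
by rewrite tens_coactE tens_coact_counit_aux !coact_counit.
Qed.

Definition tens_comod : comodule := Comodule tens_coactA tens_coact_counit.

Lemma coact_tensE m n :
  coact tens_comod (m ⊗ₜ n) = tens2 tens amul (coact M m) (coact N n).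
Proof. exact: tens_coactE. Qed.

End TensComod.

Definition reg_comod : comodule := Comodule (@comulA k H) (@comul_counitr k H).

Definition injective_comodule (I : comodule) :=
  forall (X Y : comodule) (i : comod_hom X Y) (f : comod_hom X I),
    injective i -> exists g : comod_hom Y I, forall x, g (i x) = f x.

(* Equality of morphisms modulo those factoring through an injective comodule. *)
(* Such morphisms form a subgroup, injectives being closed under direct sums.   *)
Definition stably_eq (M N : comodule) (f g : M -> N) :=
  exists (I : comodule) (u : comod_hom M I) (v : comod_hom I N),
    injective_comodule I /\ forall m, f m - g m = v (u m).

Definition stable_equivalence (M N : comodule) (f : comod_hom M N) :=
  exists g : comod_hom N M,
    stably_eq (g \o f : M -> M) id /\ stably_eq (f \o g : N -> N) id.

Record left_integral := LeftIntegral {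
  integral :> {linear H -> k^o};
  left_integralP : forall h,
    tcontr _ integral (comul H h) = (integral h : k)%:A
}.

(* [integralS_colinear]: Lam o S is colinear, k having trivial coaction *)
Section IntegralS.
Variable Lam : left_integral.

Definition integralS : {linear H -> k^o} := Lam \o antipode H.

Local Notation mul2 := (tens2 (@amul k H) (@amul k H)).
Local Notation S := (antipode H).

Let B1 (z : H ⊗ H) (y : H) : H ⊗ H := mul2 z (1 ⊗ₜ S y).
Let B2 (a : H) (w : H ⊗ H) : H ⊗ H := mul2 (comul H (S a)) w.
Let B3 (a b : H) : H ⊗ H := mul2 (comul H (S a)) (b ⊗ₜ 1).

Let B1_lin : bilinear_for *:%R *:%R B1.
Proof.
split=> [y|z] c u v; rewrite /B1 /=; first by rewrite tens2Dl tens2Zl.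
by rewrite linearP tensDr tensZr tens2Dr tens2Zr.
Qed.
Let B2_lin : bilinear_for *:%R *:%R B2.
Proof.
split=> [y|z] c u v; rewrite /B2 /=; last by rewrite tens2Dr tens2Zr.
by rewrite !linearP tens2Dl tens2Zl.
Qed.
Let B3_lin : bilinear_for *:%R *:%R B3.
Proof.
split=> [y|z] c u v; rewrite /B3 /=; last by rewrite tensDl tensZl tens2Dr tens2Zr.
by rewrite !linearP tens2Dl tens2Zl.
Qed.

#[local] HB.instance Definition _ :=
  bilinear_isBilinear.Build k (H ⊗ H) H (H ⊗ H) *:%R *:%R B1 B1_lin.
#[local] HB.instance Definition _ :=
  bilinear_isBilinear.Build k H (H ⊗ H) (H ⊗ H) *:%R *:%R B2 B2_lin.
#[local] HB.instance Definition _ :=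
  bilinear_isBilinear.Build k H H (H ⊗ H) *:%R *:%R B3 B3_lin.

Let l1 : {linear (H ⊗ H) ⊗ H -> H ⊗ H} := tlift B1.
Let l2 : {linear H ⊗ (H ⊗ H) -> H ⊗ H} := tlift B2.
Let l3 : {linear H ⊗ H -> H ⊗ H} := tlift B3.
Let mulH : {linear H ⊗ H -> H} := tlift (@amul k H).
Let mSl : {linear H ⊗ H -> H} := mulH \o tmap S idfun.
Let mSr : {linear H ⊗ H -> H} := mulH \o tmap idfun S.
Let d1 : {linear H ⊗ H -> (H ⊗ H) ⊗ H} := tmap (comul H) idfun.

Let l1d1 : {linear H ⊗ H -> H ⊗ H} := l1 \o d1.
Let cS : {linear H ⊗ H -> H ⊗ H} := comul H \o mSl.

Let l1E z y : l1 (z ⊗ₜ y) = B1 z y. Proof. exact: tliftE. Qed.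
Let l2E z y : l2 (z ⊗ₜ y) = B2 z y. Proof. exact: tliftE. Qed.
Let l3E z y : l3 (z ⊗ₜ y) = B3 z y. Proof. exact: tliftE. Qed.
Let d1E z y : d1 (z ⊗ₜ y) = comul H z ⊗ₜ y. Proof. exact: tmapE. Qed.
Let mSlE (a b : H) : mSl (a ⊗ₜ b) = S a * b.
Proof. by rewrite /mSl /mulH /= tmapE tliftE. Qed.
Let mSrE (a b : H) : mSr (a ⊗ₜ b) = a * S b.
Proof. by rewrite /mSr /mulH /= tmapE tliftE. Qed.

Let mul2A x y z : mul2 x (mul2 y z) = mul2 (mul2 x y) z.
Proof.
elim/tens_ind: x => [u v hu hv|a a']; first by rewrite !tens2Dl hu hv.
elim/tens_ind: y => [u v hu hv|b b'].
  by rewrite tens2Dl !tens2Dr tens2Dl hu hv.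
elim/tens_ind: z => [u v hu hv|c c']; first by rewrite !tens2Dr hu hv.
by rewrite !tens2E /= /amul !mulrA.
Qed.

Let l1_assoc t : l1 t = tmap idfun mSr (tassoc t).
Proof.
elim/tens_ind: t => [u v hu hv|z y]; first by rewrite !linearD hu hv.
elim/tens_ind: z => [u v hu hv|p q].
  by rewrite tensDl !linearD hu hv.
by rewrite tassocE tmapE mSrE l1E /B1 tens2E /= /amul mulr1.
Qed.

Let l1_comul b : l1 (d1 (comul H b)) = b ⊗ₜ 1.
Proof.
rewrite l1_assoc comulA -[in RHS](comul_counitr b).
elim/tens_ind: (comul H b) => [u v hu hv|p q].
  by rewrite !linearD hu hv tensDl.
rewrite !tmapE tcontrE tensZl -tensZr; congr (_ ⊗ₜ _).
exact: antipodeR.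
Qed.

Let l3_l2 w : l3 w = l2 (tmap idfun l1d1 (tmap idfun (comul H) w)).
Proof.
elim/tens_ind: w => [u v hu hv|p q]; first by rewrite !linearD hu hv.
by rewrite !tmapE l2E l3E [l1d1 _]l1_comul.
Qed.

Let l2_assoc t :
  l2 (tmap idfun l1d1 (tassoc t)) =
  l1 (tmap cS idfun t).
Proof.
elim/tens_ind: t => [u v hu hv|z y]; first by rewrite !linearD hu hv.
elim/tens_ind: z => [u v hu hv|p q].
  by rewrite tensDl !linearD hu hv.
rewrite tassocE !tmapE l2E l1E /B1.
have -> : l1d1 (q ⊗ₜ y) = B1 (comul H q) y.
  by rewrite -l1E -d1E.
have -> : cS (p ⊗ₜ q) = mul2 (comul H (S p)) (comul H q).
  by rewrite -comulM -mSlE.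
by rewrite /B2 /B1 mul2A.
Qed.

Let l1_antipode w :
  l1 (tmap cS idfun (d1 w)) = 1 ⊗ₜ S (tcontl _ (counit H) w).
Proof.
elim/tens_ind: w => [u v hu hv|p q]; first by rewrite !linearD hu hv tensDr.
rewrite d1E tmapE l1E tcontlE.
have -> : cS (comul H p) = (counit H p : k) *: (1 ⊗ₜ 1).
  by rewrite -comul1 -linearZ; congr (comul H _); apply: antipodeL.
by rewrite /B1 tens2Zl tens2E /= linearZ tensZr /amul !mul1r.
Qed.

Let l3_comul h : l3 (comul H h) = 1 ⊗ₜ S h.
Proof. by rewrite l3_l2 -comulA l2_assoc l1_antipode comul_counitl. Qed.

Let tcontr_mul2 z (b : H) :
  tcontr _ Lam (mul2 z (b ⊗ₜ 1)) = amul (tcontr _ Lam z) b.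
Proof.
elim/tens_ind: z => [u v hu hv|p q].
  by rewrite tens2Dl !linearD hu hv /amul mulrDl.
by rewrite tens2E !tcontrE /= /amul mulr1 scalerAl.
Qed.

Let tcontr_l3 w : tcontr _ Lam (l3 w) = tcontl _ integralS w.
Proof.
elim/tens_ind: w => [u v hu hv|p q]; first by rewrite !linearD hu hv.
rewrite l3E tcontlE /B3 tcontr_mul2 left_integralP.
by rewrite /amul mulr_algl.
Qed.

Lemma integralS_colinear h :
  tcontl _ integralS (comul H h) = (integralS h : k)%:A.
Proof. by rewrite -tcontr_l3 l3_comul tcontrE. Qed.

End IntegralS.

(* Unital associative algebra with a colinear multiplication and unit. An    *)
(* [algType] would exclude the zero algebra, hence the explicit operations.  *)
(* [ca_one_coact] says that k -> A is colinear, k having trivial coaction.   *)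
Record comodAlg := ComodAlg {
  ca_comod :> comodule;
  ca_mul : {bilinear ca_comod -> ca_comod -> ca_comod};
  ca_one : ca_comod;
  ca_mulA : forall a b c, ca_mul a (ca_mul b c) = ca_mul (ca_mul a b) c;
  ca_mul1l : forall a, ca_mul ca_one a = a;
  ca_mul1r : forall a, ca_mul a ca_one = a;
  ca_mul_colinear : @colinear (tens_comod ca_comod ca_comod) ca_comod (tlift ca_mul);
  ca_one_coact : coact ca_comod ca_one = ca_one ⊗ₜ 1
}.

Section LMod.
Variable A : comodAlg.

Record lmodComod := LmodComod {
  lc_comod :> comodule;
  lc_act : {bilinear A -> lc_comod -> lc_comod};
  lc_act1 : forall m, lc_act (ca_one A) m = m;
  lc_actA : forall a b m, lc_act a (lc_act b m) = lc_act (ca_mul A a b) m;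
  lc_act_colinear : @colinear (tens_comod A lc_comod) lc_comod (tlift lc_act)
}.

Definition act_linear (M N : lmodComod) (f : M -> N) :=
  forall a m, f (lc_act M a m) = lc_act N a (f m).

Record lmc_hom (M N : lmodComod) := LmcHom {
  lmc_hom_fun :> comod_hom M N;
  lmc_hom_act : act_linear lmc_hom_fun
}.


Program Definition hom_id (M : lmodComod) : lmc_hom M M :=
  @LmcHom M M (@ComodHom M M idfun _) _.
Next Obligation.
by move=> m; rewrite tmap_id.
Qed.
Next Obligation. by move=> a m. Qed.

Program Definition hom_comp (M N P : lmodComod)
    (g : lmc_hom N P) (f : lmc_hom M N) : lmc_hom M P :=
  @LmcHom M P (@ComodHom M P (g \o f) _) _.
Next Obligation.
move=> m; rewrite comod_hom_colinear comod_hom_colinear -tmap_comp.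
exact: eq_tmap.
Qed.
Next Obligation. by move=> a m /=; rewrite !lmc_hom_act. Qed.

Record lmc_functor := LmcFunctor {
  fobj :> lmodComod -> lmodComod;
  fmap : forall M N, lmc_hom M N -> lmc_hom (fobj M) (fobj N);
  fmap_id : forall M x, fmap (hom_id M) x = x;
  fmap_comp : forall M N P (g : lmc_hom N P) (f : lmc_hom M N) x,
    fmap (hom_comp g f) x = fmap g (fmap f x)
}.

Definition cofibrant (P : lmodComod) :=
  forall (L N : lmodComod) (f : lmc_hom L N),
    stable_equivalence f -> (forall n, exists l, f l = n) ->
    forall g : lmc_hom P N, exists h : lmc_hom P L, forall p, f (h p) = g p.

Definition short_exact (M N P : lmodComod) (i : lmc_hom M N) (q : lmc_hom N P) :=
  [/\ injective i,
      forall n, q n = 0 <-> exists m, i m = n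
    & forall p, exists n, q n = p].

Definition act_split (N P : lmodComod) (q : lmc_hom N P) :=
  exists s : {linear P -> N}, act_linear s /\ forall p, q (s p) = p.

Section TensH.
Variable N : lmodComod.

Definition tensH_act_fun (a : A) : {linear N ⊗ H -> N ⊗ H} :=
  tmap (lc_act N a) idfun.

Definition tensH_act (a : A) (x : N ⊗ H) : N ⊗ H := tensH_act_fun a x.

Fact tensH_act_lin : bilinear_for *:%R *:%R tensH_act.
Proof.
split=> [x c a b|a c x y]; rewrite /tensH_act; last exact: linearP.
change (tensH_act_fun (c *: a + b) x =
        c *: tensH_act_fun a x + tensH_act_fun b x).
elim/tens_ind: x => [x y hx hy|n h].
  by rewrite !linearD hx hy addrACA.
rewrite !tmapE /=.
have -> : lc_act N (c *: a + b) n = c *: lc_act N a n + lc_act N b n.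
  exact: (linearPl (lc_act N)).
by rewrite tensDl tensZl.
Qed.

HB.instance Definition _ :=
  bilinear_isBilinear.Build k A (N ⊗ H) (N ⊗ H) *:%R *:%R
    tensH_act tensH_act_lin.

Lemma tensH_actE a n h : tensH_act a (n ⊗ₜ h) = lc_act N a n ⊗ₜ h.
Proof. exact: tmapE. Qed.

Lemma tensH_actD a x y : tensH_act a (x + y) = tensH_act a x + tensH_act a y.
Proof. exact: (linearDr tensH_act). Qed.

Fact tensH_act1 x : tensH_act (ca_one A) x = x.
Proof.
elim/tens_ind: x => [x y hx hy|n h]; first by rewrite tensH_actD hx hy.
by rewrite tensH_actE lc_act1.
Qed.

Fact tensH_actA a b x :
  tensH_act a (tensH_act b x) = tensH_act (ca_mul A a b) x.
Proof.
elim/tens_ind: x => [x y hx hy|n h]; first by rewrite !tensH_actD hx hy.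
by rewrite !tensH_actE lc_actA.
Qed.

Lemma lc_act_coact a (n : N) : coact N (lc_act N a n) =
  tmap (tlift (lc_act N)) idfun (tens2 tens amul (coact A a) (coact N n)).
Proof. by have := lc_act_colinear (a ⊗ₜ n); rewrite /= tliftE tens_coactE. Qed.

Fact tensH_act_colinear :
  @colinear (tens_comod A (tens_comod N reg_comod)) (tens_comod N reg_comod)
    (tlift tensH_act).
Proof.
elim/tens_ind=> [x y hx hy|a x]; first by rewrite !linearD hx hy.
rewrite coact_tensE.
have -> : (tlift tensH_act : {linear A ⊗ (N ⊗ H) -> N ⊗ H}) (a ⊗ₜ x) = tensH_act a x.
  exact: tliftE.
elim/tens_ind: x => [x y hx hy|n h].
  by rewrite tensH_actD !linearD hx hy tens2Dr linearD.
rewrite tensH_actE !coact_tensE lc_act_coact.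
elim/tens_ind: (coact A a) => [x y hx hy|a' g].
  by rewrite !tens2Dl !linearD tens2Dl hx hy.
elim/tens_ind: (coact N n) => [x y hx hy|n' g'].
  by rewrite tens2Dr !linearD !tens2Dl hx hy tens2Dr linearD.
elim/tens_ind: (comul H h) => [x y hx hy|h' g''].
  by rewrite !tens2Dr hx hy linearD.
rewrite !tens2E !tmapE tens2E /= !tliftE /= tensH_actE.
by rewrite /amul mulrA.
Qed.

Definition tensH : lmodComod :=
  @LmodComod (tens_comod N reg_comod) tensH_act tensH_act1 tensH_actA
    tensH_act_colinear.

End TensH.

(* The kernel of f in LMod_A(M^H). Its coaction is the restriction of that of  *)
(* X, and is determined by [kerc_inc_colinear]; the pseudo-inverse g only serves *)
(* to see that this restriction takes values in ker f ⊗ H.                      *)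
Section KerObj.
Variables (X Y : lmodComod) (f : lmc_hom X Y).
Variables (g : {linear Y -> X}) (fgf : forall x, f (g (f x)) = f x).

Local Notation K := (ker f).
Let i : {linear K -> X} := ker_inc f.
Let r : {linear X -> K} := ker_retr fgf.

Definition kerc_coact : {linear K -> K ⊗ H} :=
  tmap r idfun \o (coact X \o i).

Let ir : {linear X -> X} := i \o r.

Lemma kerc_inc_colinear x : coact X (i x) = tmap i idfun (kerc_coact x).
Proof.
rewrite [kerc_coact x](_ : _ = tmap r idfun (coact X (i x))) // -tmap_comp.
have -> : tmap (i \o r) (idfun \o idfun) (coact X (i x)) =
          tmap ir idfun (coact X (i x)) by exact: eq_tmap.
have E (z : X ⊗ H) : z - tmap g idfun (tmap f idfun z) = tmap ir idfun z.
  elim/tens_ind: z => [u v hu hv|v h].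
    by rewrite !linearD -hu -hv addrACA.
  by rewrite !tmapE -tensBl.
by rewrite -E -comod_hom_colinear ker_incP !linear0 addr0.
Qed.

Let tmapK (x : K ⊗ H) : tmap r idfun (tmap i idfun x) = x.
Proof.
rewrite -tmap_comp -[RHS]tmap_id; apply: eq_tmap => // y; exact: ker_incK.
Qed.

Let tmap_i_inj : injective (tmap i (idfun : {linear H -> H})).
Proof. exact: can_inj tmapK. Qed.

Let act_in (a : A) (x : K) : lc_act X a (i x) \in ker_pred f.
Proof.
by apply/eqP; rewrite lmc_hom_act ker_incP (linear0r (lc_act Y)).
Qed.

Definition kerc_act (a : A) (x : K) : K := Ker (act_in a x).

Lemma kerc_inc_act a x : i (kerc_act a x) = lc_act X a (i x).
Proof. by []. Qed.

Fact kerc_act_lin : bilinear_for *:%R *:%R kerc_act.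
Proof.
split=> [x c a b|a c x y]; apply: (@ker_inc_inj _ _ _ f);
  rewrite [RHS]linearP !kerc_inc_act.
- exact: (linearPl (lc_act X)).
- have -> : i (c *: x + y) = c *: i x + i y by exact: linearP.
  exact: (linearPr (lc_act X)).
Qed.

HB.instance Definition _ :=
  bilinear_isBilinear.Build k A K K *:%R *:%R kerc_act kerc_act_lin.

Fact kerc_coactA x :
  tassoc (tmap kerc_coact idfun (kerc_coact x)) =
  tmap idfun (comul H) (kerc_coact x).
Proof.
have inj2 : injective (tmap i (idfun : {linear H ⊗ H -> H ⊗ H})).
  apply: (@can_inj _ _ _ (tmap r idfun)) => z.
  rewrite -tmap_comp -[RHS]tmap_id; apply: eq_tmap => // y; exact: ker_incK.
apply: inj2.
have Ea (z : (K ⊗ H) ⊗ H) : tmap i idfun (tassoc z) =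
    tassoc (tmap (tmap i idfun) idfun z).
  elim/tens_ind: z => [u v hu hv|z h]; first by rewrite !linearD hu hv.
  elim/tens_ind: z => [u v hu hv|y g'].
    by rewrite tensDl !linearD hu hv.
  by rewrite tassocE !tmapE tassocE.
rewrite Ea -tmap_comp.
have -> (z : K ⊗ H) : tmap (tmap i idfun \o kerc_coact) (idfun \o idfun) z =
    tmap (coact X) idfun (tmap i idfun z).
  by rewrite -tmap_comp; apply: eq_tmap => // y; rewrite [RHS]kerc_inc_colinear.
rewrite -kerc_inc_colinear coactA kerc_inc_colinear -!tmap_comp.
exact: eq_tmap.
Qed.

Fact kerc_coact_counit x : tcontr _ (counit H) (kerc_coact x) = x.
Proof.
apply: (@ker_inc_inj _ _ _ f); rewrite -[RHS]coact_counit kerc_inc_colinear.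
elim/tens_ind: (kerc_coact x) => [u v hu hv|y h]; first by rewrite !linearD hu hv.
by rewrite tmapE !tcontrE linearZ.
Qed.

Definition kerc_comod : comodule := Comodule kerc_coactA kerc_coact_counit.

Fact kerc_act1 x : kerc_act (ca_one A) x = x.
Proof. by apply: (@ker_inc_inj _ _ _ f); rewrite kerc_inc_act lc_act1. Qed.

Fact kerc_actA a b x : kerc_act a (kerc_act b x) = kerc_act (ca_mul A a b) x.
Proof. by apply: (@ker_inc_inj _ _ _ f); rewrite !kerc_inc_act lc_actA. Qed.

Fact kerc_act_colinear :
  @colinear (tens_comod A kerc_comod) kerc_comod (tlift kerc_act).
Proof.
elim/tens_ind=> [x y hx hy|a x]; first by rewrite !linearD hx hy.
have -> : (tlift kerc_act : {linear A ⊗ K -> K}) (a ⊗ₜ x) = kerc_act a x.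
  exact: tliftE.
apply: tmap_i_inj; rewrite -kerc_inc_colinear kerc_inc_act lc_act_coact.
rewrite coact_tensE kerc_inc_colinear.
elim/tens_ind: (coact A a) => [u v hu hv|a' g'].
  by rewrite !tens2Dl !linearD hu hv.
elim/tens_ind: (kerc_coact x) => [u v hu hv|y h].
  by rewrite linearD !tens2Dr !linearD hu hv.
by rewrite tmapE !tens2E !tmapE /= !tliftE.
Qed.

Definition kerc : lmodComod :=
  @LmodComod kerc_comod kerc_act kerc_act1 kerc_actA kerc_act_colinear.

Definition kerc_inc : lmc_hom kerc X :=
  @LmcHom kerc X (@ComodHom kerc X i kerc_inc_colinear) kerc_inc_act.

End KerObj.

Section SigmaInv.
Variables (Lam : left_integral) (N : lmodComod).

(* id ⊗ Lam' : N ⊗ H -> N ⊗ k ≅ N *)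
Definition id_integralS : {linear tensH N -> N} := tcontr N (integralS Lam).

Fact id_integralS_colinear : @colinear (tensH N) N id_integralS.
Proof.
elim/tens_ind=> [x y hx hy|n h]; first by rewrite !linearD hx hy.
rewrite [id_integralS _]tcontrE coact_tensE.
have -> : coact N ((integralS Lam h : k) *: n) =
    (integralS Lam h : k) *: coact N n by exact: linearZ.
elim/tens_ind: (coact N n) => [x y hx hy|n' a].
  by rewrite scalerDr hx hy tens2Dl linearD.
have E (y : H ⊗ H) : tmap id_integralS idfun (tens2 tens amul (n' ⊗ₜ a) y) =
    n' ⊗ₜ amul a (tcontl _ (integralS Lam) y).
  elim/tens_ind: y => [x y hx hy|b c].
    by rewrite tens2Dr !linearD hx hy (linearDr amul) tensDr.
  rewrite tens2E !tmapE [id_integralS _]tcontrE tcontlE tensZl -tensZr.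
  by congr (_ ⊗ₜ _); rewrite /amul scalerAr.
rewrite [RHS]E integralS_colinear -tensZr.
by congr (_ ⊗ₜ _); rewrite /amul -scalerAr mulr1.
Qed.

Fact id_integralS_act : act_linear (id_integralS : tensH N -> N).
Proof.
move=> a; elim/tens_ind=> [x y hx hy|n h].
  by rewrite [lc_act (tensH N) a _]tensH_actD !linearD hx hy.
rewrite [lc_act (tensH N) a _]tensH_actE ![id_integralS _]tcontrE.
by rewrite (linearZr_LR (lc_act N)).
Qed.

Definition id_integralS_hom : lmc_hom (tensH N) N :=
  @LmcHom (tensH N) N (@ComodHom (tensH N) N id_integralS id_integralS_colinear)
    id_integralS_act.

Fact id_integralS_pinv :
  exists g : {linear N -> tensH N},
    forall x, id_integralS (g (id_integralS x)) = id_integralS x.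
Proof.
suff [h hP] : exists h, forall x : N ⊗ H,
    (integralS Lam h : k) *: id_integralS x = id_integralS x.
  have lin : linear (fun n : N => n ⊗ₜ h).
    by move=> a n n'; rewrite tensDl tensZl.
  pose g : {linear N -> tensH N} := HB.pack (fun n : N => n ⊗ₜ h)
    (GRing.isLinear.Build k N (tensH N) *:%R (fun n : N => n ⊗ₜ h) lin).
  by exists g => x; rewrite [LHS]tcontrE hP.
have [[h nz]|z] := pselect (exists h : H, integralS Lam h != 0).
  exists ((integralS Lam h : k)^-1 *: h) => x.
  have -> : integralS Lam ((integralS Lam h : k)^-1 *: h) = 1.
    by rewrite [LHS]linearZ; apply: mulVf.
  by rewrite scale1r.
exists 0 => x; rewrite linear0 scale0r.
elim/tens_ind: x => [x y hx hy|n h]; first by rewrite linearD -hx -hy addr0.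
rewrite [RHS]tcontrE; have [->|nz] := eqVneq (integralS Lam h) 0.
  by rewrite scale0r.
by case: z; exists h.
Qed.

Definition sigma_inv : lmodComod :=
  @kerc _ _ id_integralS_hom _ (projT2 (cid id_integralS_pinv)).

Definition sigma_inv_inc : lmc_hom sigma_inv (tensH N) :=
  @kerc_inc _ _ id_integralS_hom _ (projT2 (cid id_integralS_pinv)).

Lemma sigma_inv_inc_inj : injective sigma_inv_inc.
Proof. exact: ker_inc_inj. Qed.

Lemma sigma_inv_incP x :
  id_integralS x = 0 <-> exists y, sigma_inv_inc y = x.
Proof.
split=> [/eqP x0|[y <-]]; last exact: ker_incP.
by exists (@Ker _ _ _ id_integralS x x0).
Qed.

End SigmaInv.
End LMod.
End Comodules.

(* Main.v *)
Require Import Defs.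
From HB Require Import structures.
From mathcomp Require Import all_boot all_order all_algebra.
From mathcomp Require Import boolp classical_sets functions.

Set Implicit Arguments.
Unset Strict Implicit.
Unset Printing Implicit Defensive.

Import GRing.Theory.
Local Open Scope ring_scope.

(** For every M in LMod_A(M^H), aM is the free object under M among those X that come
    with a colinear map r : X ⊗ H -> X such that r (x ⊗ 1) = x; such a map is called
    absorbing. Everything follows from this universal property.

    A comodule is injective exactly when it has an absorbing map: X ⊗ H with the
    diagonal coaction is isomorphic to the cofree comodule on X, by
    x ⊗ h |-> x0 ⊗ x1 h. So aM is injective ([absorbing_injective]). It is functorial
    in M. Since M ⊗ H is absorbing by multiplication on H, the map m |-> m ⊗ 1 extends
    to aM, and composing with the counit gives an A-linear retraction of M -> aM.
    Hence M -> aM is injective and its cokernel p̄M splits off A-linearly.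

    The object aM is built as a quotient of the set of formal expressions in the
    elements of M, the linear operations, the action of A and absorption by elements
    of H, two expressions being equal if they agree in all models; the coaction
    comes from the universal property, because X ⊗ H is a model when X is.

    Cofibrancy uses the nonzero integral Λ. Averaging with Λ shows that injective
    comodules are projective ([injective_lift]); therefore a surjective stable
    equivalence f : L -> N has a colinear section s, and its kernel K is an injective
    comodule, hence has an absorbing map. A morphism φ from aM to N killing M is then
    lifted to s φ + κ, where κ : aM -> K is defined by recursion over aM: the
    recursion corrects the failure of s to be A-linear, and on absorbed elements uses
    the absorbing map of K. The same works for aM ⊗ Z with any comodule Z
    ([free_lift]). Taking Z = k gives the cofibrancy of p̄M, and taking Z = ker Λ'
    that of its desuspension, which is p̄M ⊗ ker Λ'. *)

(** * Linear algebra over a field *)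

Section PseudoInverse.
Variables (k : fieldType) (X Y : lmodType k) (f : {linear X -> Y}).
Implicit Type G : set (Y * X).

(** The graphs of partially defined linear maps with the property of [linear_pinv]:
    the ordered set to which Zorn's lemma is applied. *)
Definition partial_pinv G :=
  [/\ forall a p q, G p -> G q -> G (a *: p + q),
      forall x, G (0, x) -> x = 0
    & forall y x, G (y, x) -> (exists x', f x' = y) -> f x = y].

Lemma partial_pinv_extend G y1 x1 :
    partial_pinv G -> G 0 -> ~ (exists x, G (y1, x)) ->
    (forall c y x, G (y, x) -> (exists x', f x' = c *: y1 + y) ->
       f (c *: x1 + x) = c *: y1 + y) ->
  partial_pinv [set p | exists c q, G q /\ p = c *: (y1, x1) + q].
Proof.
move=> [Glin Gfun Gpinv] G0 y1G Gext; split=> /=.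
- move=> a p q [c [p' [Gp' ->]]] [d [q' [Gq' ->]]].
  exists (a * c + d), (a *: p' + q'); split; first exact: Glin.
  by rewrite scalerDr scalerA scalerDl addrACA.
- move=> x [c [[y x'] [Gq]]] [/esym/eqP]; rewrite addr_eq0 => /eqP E ->.
  have [c0|c0] := eqVneq c 0.
    move: E Gq; rewrite c0 scale0r => /esym/eqP; rewrite oppr_eq0 => /eqP ->.
    by move/Gfun ->; rewrite scale0r addr0.
  case: y1G; exists (- c^-1 *: x').
  have := Glin (- c^-1) _ _ Gq G0; rewrite addr0.
  congr G; congr pair => /=.
  by rewrite scaleNr -scalerN -E scalerA mulVf // scale1r.
- by move=> y x [c [[y' x'] [Gq]]] [-> ->]; apply: Gext.
Qed.

(** Zorn's lemma: a maximal partial pseudo-inverse is defined everywhere. *)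
Lemma maximal_partial_pinv :
  exists G, [/\ partial_pinv G, G 0 & forall y, exists x, G (y, x)].
Proof.
have chain F : (F `<=` partial_pinv)%classic -> total_on F subset ->
    partial_pinv (\bigcup_(G in F) G)%classic.
  move=> FP Ftot; split.
  - move=> a p q [G FG Gp] [G' FG' Gq]; have [GG|GG] := Ftot _ _ FG FG'.
      by exists G' => //; have [+ _ _] := FP _ FG'; apply => //; apply: GG.
    by exists G => //; have [+ _ _] := FP _ FG; apply => //; apply: GG.
  - by move=> x [G /FP[_ + _]]; apply.
  - by move=> y x [G /FP[_ _]]; apply.
have [G [PG Gmax]] := Zorn_bigcup chain.
(* The empty chain forces the empty graph to be admitted, but it is not maximal. *)
have G0 : G 0.
  apply: contrapT => nG0.
  have nG p : ~ G p.
    by case: PG => Glin _ _ Gp; apply: nG0; rewrite -(subrr p) addrC -scaleN1r; apply: Glin.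
  apply: (Gmax [set 0]%classic).
    by split=> [p /nG//|sub]; apply: nG0; apply: sub.
  split=> [a p q -> ->|x [->]|y x [-> ->] _] //=; last by rewrite linear0.
  by rewrite scaler0 addr0.
exists G; split=> // y0; apply: contrapT => y0G.
have [Glin Gfun Gpinv] := PG.
have absurd y1 x1 : ~ (exists x, G (y1, x)) ->
    (forall c y x, G (y, x) -> (exists x', f x' = c *: y1 + y) ->
       f (c *: x1 + x) = c *: y1 + y) -> False.
  move=> y1G /(partial_pinv_extend PG G0 y1G); apply: Gmax; split.
    by move=> p Gp; exists 0, p; rewrite scale0r add0r.
  move=> sub; apply: y1G; exists x1; apply: sub; exists 1, 0.
  by rewrite scale1r addr0.
(* If y0 differs from some f x1 by a d in the domain of G, extend G by f x1 |-> x1; *)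
(* otherwise adding y0 to the domain adds no element of the image of f.             *)
have [[d [x [Gd [x1 Ex1]]]]|no] :=
    pselect (exists d x, G (d, x) /\ exists x1, f x1 = y0 - d).
  apply: (absurd (y0 - d) x1) => [[x2 G2]|c y x3 Gy [x' Ex']].
    apply: y0G; exists (x2 + x); have := Glin 1 _ _ G2 Gd.
    by rewrite scale1r; congr G; congr pair => /=; rewrite subrK.
  rewrite linearP Ex1 (Gpinv _ _ Gy) //; exists (x' - c *: x1).
  by rewrite linearB linearZ Ex' /= Ex1 [_ + y]addrC addrK.
apply: (absurd y0 0) => // c y x Gy [x' Ex'].
have [c0|c0] := eqVneq c 0.
  move: Ex'; rewrite c0 !scale0r !add0r => Ex'.
  by apply: (Gpinv _ _ Gy); exists x'.
case: no; exists (- c^-1 *: y), (- c^-1 *: x); split.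
  by have := Glin (- c^-1) _ _ Gy G0; rewrite addr0.
exists (c^-1 *: x'); rewrite linearZ /= Ex' scalerDr scalerA mulVf // scale1r.
by rewrite scaleNr opprK.
Qed.

(** Linear retractions of injections, linear sections of surjections and the
    splitting off of kernels are all instances of this. *)
Lemma linear_pinv : exists g : {linear Y -> X}, forall x, f (g (f x)) = f x.
Proof.
have [G [[Glin Gfun Gpinv] G0 Gtot]] := maximal_partial_pinv.
pose g y := projT1 (cid (Gtot y)).
have gP y : G (y, g y) by exact: projT2 (cid (Gtot y)).
have g_lin : linear g.
  move=> a y y'; apply/eqP; rewrite -subr_eq0; apply/eqP/Gfun.
  have := Glin (-1) _ _ (Glin a _ _ (gP y) (gP y')) (gP (a *: y + y')).
  congr G; apply: injective_projections => /=; first by rewrite scaleN1r addNr.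
  by rewrite scaleN1r; exact: addrC.
pose gl : {linear Y -> X} :=
  HB.pack g (GRing.isLinear.Build k Y X *:%R g g_lin).
by exists gl => x; apply: (Gpinv _ _ (gP (f x))); exists x.
Qed.

End PseudoInverse.

Lemma linear_retraction (k : fieldType) (X Y : lmodType k) (i : {linear X -> Y}) :
  injective i -> exists r : {linear Y -> X}, cancel i r.
Proof. by move=> inj; have [g gP] := linear_pinv i; exists g => x; apply: inj. Qed.

Lemma linear_section (k : fieldType) (X Y : lmodType k) (f : {linear X -> Y}) :
    (forall y, exists x, f x = y) ->
  exists s : {linear Y -> X}, cancel s f.
Proof.
move=> surj; have [g gP] := linear_pinv f; exists g => y.
by have [x <-] := surj y.
Qed.

Section LinMap.
Variables (k : fieldType) (V W : lmodType k).

(** The vector space of linear maps, as a subspace of all functions. *)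
Definition lin_pred : {pred (V -> W)} := fun u => `[< linear u >].

Fact lin_submod_closed : submod_closed lin_pred.
Proof.
split=> [|a u v /asboolP hu /asboolP hv]; apply/asboolP => b x y.
  by rewrite /= scaler0 addr0.
rewrite [LHS](_ : _ = a *: u (b *: x + y) + v (b *: x + y)) // hu hv.
rewrite scalerDr scalerA mulrC -scalerA addrACA -scalerDr.
by [].
Qed.

HB.instance Definition _ :=
  GRing.isSubmodClosed.Build k (V -> W) lin_pred lin_submod_closed.

Record linmap := LinMap { linmap_val :> V -> W; linmap_valP : linmap_val \in lin_pred }.

HB.instance Definition _ := [isSub for linmap_val].
HB.instance Definition _ := [Choice of linmap by <:].
HB.instance Definition _ := [SubChoice_isSubLmodule of linmap by <:].

Fact linmap_linear (u : linmap) : linear u.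
Proof. by case: u => u /= /asboolP. Qed.

HB.instance Definition _ (u : linmap) :=
  GRing.isLinear.Build k V W *:%R (linmap_val u) (linmap_linear u).

Definition linmap_lin (u : linmap) : {linear V -> W} := linmap_val u.

Definition linmap_of (u : {linear V -> W}) : linmap := LinMap (asboolT (linearP u)).

Lemma linmapP (u v : linmap) : u =1 v -> u = v.
Proof. by move=> uv; apply: val_inj; apply: funext. Qed.

End LinMap.

(** * Complements on tensor products *)

Section TensorComplements.
Variable k : fieldType.
Implicit Types U V W X Y Z T : lmodType k.

Section AssocInverse.
Variables U V W : lmodType k.

Definition tassocV_fun (u : U) (t : V ⊗ W) : (U ⊗ V) ⊗ W :=
  tmap ((tens : {bilinear U -> V -> U ⊗ V}) u) idfun t.

Fact tassocV_lin : bilinear_for *:%R *:%R tassocV_fun.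
Proof.
split=> [t a u u'|u a t t']; last exact: linearP.
rewrite /tassocV_fun; elim/tens_ind: t => [x y hx hy|v w].
  by rewrite !linearD /= hx hy scalerDr addrACA.
by rewrite !tmapE /= tensDl tensZl tensDl tensZl.
Qed.

HB.instance Definition _ :=
  bilinear_isBilinear.Build k U (V ⊗ W) ((U ⊗ V) ⊗ W) *:%R *:%R tassocV_fun
    tassocV_lin.

Definition tassocV : {linear U ⊗ (V ⊗ W) -> (U ⊗ V) ⊗ W} := tlift tassocV_fun.

Lemma tassocVE u v w : tassocV (u ⊗ₜ (v ⊗ₜ w)) = (u ⊗ₜ v) ⊗ₜ w.
Proof. by rewrite /tassocV /= tliftE /tassocV_fun tmapE. Qed.

Lemma tassocK : cancel (@tassoc k U V W) tassocV.
Proof.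
elim/tens_ind=> [x y hx hy|t w]; first by rewrite !linearD hx hy.
elim/tens_ind: t => [x y hx hy|u v]; first by rewrite tensDl !linearD hx hy.
by rewrite tassocE tassocVE.
Qed.

End AssocInverse.

(** Turns a diagonal coaction followed by a bilinear map on the first factor
    into a single [tens2], the form in which [tens2A] applies. *)
Lemma tmap_tens2 X Y Z X' Y' Z' T (b : {bilinear X -> Y -> Z})
    (b' : {bilinear X' -> Y' -> Z'}) (f : {linear Z -> T}) (c : {bilinear X -> Y -> T}) t u :
    (forall x y, f (b x y) = c x y) ->
  tmap f idfun (tens2 b b' t u) = tens2 c b' t u.
Proof.
move=> E; elim/tens_ind: t => [x y hx hy|x x'].
  by rewrite !tens2Dl linearD hx hy.
elim/tens_ind: u => [v w hv hw|y y']; first by rewrite !tens2Dr linearD hv hw.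
by rewrite !tens2E tmapE E.
Qed.

Lemma tmapDr V W W' (f g h : {linear W -> W'}) (t : V ⊗ W) :
  (forall w, h w = f w + g w) -> tmap idfun h t = tmap idfun f t + tmap idfun g t.
Proof.
move=> E; elim/tens_ind: t => [x y hx hy|v w]; first by rewrite !linearD hx hy addrACA.
by rewrite !tmapE E tensDr.
Qed.

Section Tens2Assoc.
Variables (X Y Z XY YZ T X' Y' Z' XY' YZ' T' : lmodType k).
Variables (b : {bilinear X -> YZ -> T}) (c : {bilinear Y -> Z -> YZ}).
Variables (d : {bilinear XY -> Z -> T}) (e : {bilinear X -> Y -> XY}).
Variables (b' : {bilinear X' -> YZ' -> T'}) (c' : {bilinear Y' -> Z' -> YZ'}).
Variables (d' : {bilinear XY' -> Z' -> T'}) (e' : {bilinear X' -> Y' -> XY'}).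

(** An associativity law on each tensor factor gives one for [tens2]. Applied to
    coactions, it replaces computations with Sweedler components. *)
Lemma tens2A :
    (forall x y z, b x (c y z) = d (e x y) z) ->
    (forall x y z, b' x (c' y z) = d' (e' x y) z) ->
  forall x y z, tens2 b b' x (tens2 c c' y z) = tens2 d d' (tens2 e e' x y) z.
Proof.
move=> bA b'A; elim/tens_ind=> [u v hu hv|x x'] y z; first by rewrite !tens2Dl hu hv.
elim/tens_ind: y => [u v hu hv|y y']; first by rewrite tens2Dl !tens2Dr tens2Dl hu hv.
elim/tens_ind: z => [u v hu hv|z z']; first by rewrite !tens2Dr hu hv.
by rewrite !tens2E bA b'A.
Qed.

Variables (YZ2 : lmodType k) (b2 : {bilinear X -> YZ2 -> T}).
Variable c2 : {bilinear Y -> Z -> YZ2}.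

(** The same for an associativity law with an additional term, such as
    d (e x y) z = b x (c y z) + b2 x (c2 y z), on the first factor. *)
Lemma tens2A_add :
    (forall x y z, d (e x y) z = b x (c y z) + b2 x (c2 y z)) ->
    (forall x y z, b' x (c' y z) = d' (e' x y) z) ->
  forall x y z, tens2 d d' (tens2 e e' x y) z =
    tens2 b b' x (tens2 c c' y z) + tens2 b2 b' x (tens2 c2 c' y z).
Proof.
move=> bA b'A; elim/tens_ind=> [u v hu hv|x x'] y z.
  by rewrite !tens2Dl hu hv addrACA.
elim/tens_ind: y => [u v hu hv|y y'].
  by rewrite !tens2Dl !tens2Dr !tens2Dl hu hv addrACA.
elim/tens_ind: z => [u v hu hv|z z'].
  by rewrite !tens2Dr hu hv addrACA.
by rewrite !tens2E bA b'A tensDl.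
Qed.

End Tens2Assoc.

Section BilinearCoaction.
Variables (C X Y Z : lmodType k) (Δ : {linear C -> C ⊗ C}) (ε : {linear C -> k^o}).
Variables (μ : {bilinear C -> C -> C}) (b : {bilinear X -> Y -> Z}).
Hypothesis Δμ : forall a c, Δ (μ a c) = tens2 μ μ (Δ a) (Δ c).
Hypothesis εμ : forall a c, ε (μ a c) = (ε a : k) * ε c.
Variables (δX : {linear X -> X ⊗ C}) (δY : {linear Y -> Y ⊗ C}).
Variable δZ : {linear Z -> Z ⊗ C}.
Hypothesis bδ : forall x y, δZ (b x y) = tens2 b μ (δX x) (δY y).

(** If b intertwines the coactions, the coassociativity of the coaction at b x y
    follows from coassociativity at x and at y, because Δ is multiplicative. This
    is what makes coassociativity provable by induction on generators. *)
Lemma bilinear_coassoc x y :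
    tassoc (tmap δX idfun (δX x)) = tmap idfun Δ (δX x) ->
    tassoc (tmap δY idfun (δY y)) = tmap idfun Δ (δY y) ->
  tassoc (tmap δZ idfun (δZ (b x y))) = tmap idfun Δ (δZ (b x y)).
Proof.
move=> hx hy; rewrite bδ.
have Er t u : tmap idfun Δ (tens2 b μ t u) =
    tens2 b (tens2 μ μ) (tmap idfun Δ t) (tmap idfun Δ u).
  elim/tens_ind: t => [v w hv hw|p a]; first by rewrite !(tens2Dl, linearD) hv hw.
  elim/tens_ind: u => [v w hv hw|q c]; first by rewrite !(tens2Dr, linearD) hv hw.
  by rewrite !(tmapE, tens2E) Δμ.
have Ea t u (a c : C) : tassoc (tens2 b μ t u ⊗ₜ μ a c) =
    tens2 b (tens2 μ μ) (tassoc (t ⊗ₜ a)) (tassoc (u ⊗ₜ c)).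
  elim/tens_ind: t => [v w hv hw|p e]; first by rewrite !(tens2Dl, tensDl, linearD) hv hw.
  elim/tens_ind: u => [v w hv hw|q f]; first by rewrite !(tens2Dr, tensDl, linearD) hv hw.
  by rewrite tens2E !tassocE !tens2E; congr (_ ⊗ₜ _); apply/esym/tens2E.
have El t u : tassoc (tmap δZ idfun (tens2 b μ t u)) =
    tens2 b (tens2 μ μ) (tassoc (tmap δX idfun t)) (tassoc (tmap δY idfun u)).
  elim/tens_ind: t => [v w hv hw|p a]; first by rewrite !(tens2Dl, linearD) hv hw.
  elim/tens_ind: u => [v w hv hw|q c]; first by rewrite !(tens2Dr, linearD) hv hw.
  by rewrite !(tmapE, tens2E) bδ Ea.
by rewrite El Er hx hy.
Qed.

Lemma bilinear_counit x y :
    tcontr X ε (δX x) = x -> tcontr Y ε (δY y) = y ->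
  tcontr Z ε (δZ (b x y)) = b x y.
Proof.
move=> hx hy; rewrite bδ -[in RHS]hx -[in RHS]hy.
elim/tens_ind: (δX x) => [v w hv hw|p a].
  by rewrite !(tens2Dl, linearD) hv hw linearDl.
elim/tens_ind: (δY y) => [v w hv hw|q c].
  by rewrite !(tens2Dr, linearD) hv hw.
rewrite tens2E !tcontrE εμ linearZl_LR linearZr_LR.
by rewrite scalerA.
Qed.

End BilinearCoaction.

End TensorComplements.

Arguments tassocV {k U V W}.

Section PartialApplication.
Variables (k : fieldType) (V W U : lmodType k) (b : {bilinear V -> W -> U}) (w : W).

Let bil_r_fun v := b v w.
Let bil_r_lin : linear bil_r_fun.
Proof. by move=> a x y; apply: linearPl. Qed.

Definition bil_r : {linear V -> U} :=
  HB.pack bil_r_fun (GRing.isLinear.Build k V U *:%R bil_r_fun bil_r_lin).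

End PartialApplication.

(** * Comodules, cofree comodules and untwisting *)

Section Comod.
Variables (k : fieldType) (H : hopfAlgType k).
Implicit Types X Y Z : comodule H.
Local Notation Δ := (comul H).
Local Notation S := (antipode H).
Local Notation ε := (counit H).
Local Notation mul2 := (tens2 (@amul k H) (@amul k H)).

Definition mulH : {linear H ⊗ H -> H} := tlift (@amul k H).

Lemma mulHE (a b : H) : mulH (a ⊗ₜ b) = a * b.
Proof. exact: tliftE. Qed.

Definition mulSl : {linear H ⊗ H -> H} := mulH \o tmap S idfun.
Definition mulSr : {linear H ⊗ H -> H} := mulH \o tmap idfun S.

Lemma mulSlE (a b : H) : mulSl (a ⊗ₜ b) = S a * b.
Proof. by rewrite /mulSl /= tmapE mulHE. Qed.

Lemma mulSrE (a b : H) : mulSr (a ⊗ₜ b) = a * S b.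
Proof. by rewrite /mulSr /= tmapE mulHE. Qed.

Lemma mulSl_comul h : mulSl (Δ h) = (ε h : k)%:A.
Proof. exact: antipodeL. Qed.

Lemma mulSr_comul h : mulSr (Δ h) = (ε h : k)%:A.
Proof. exact: antipodeR. Qed.

Section ComodHom.

Definition comod_id X : comod_hom X X.
Proof. by exists (idfun : {linear X -> X}) => x; rewrite tmap_id. Defined.

Definition comod_comp X Y Z (g : comod_hom Y Z) (f : comod_hom X Y) :
  comod_hom X Z.
Proof.
exists (g \o f : {linear X -> Z}) => x /=.
by rewrite !comod_hom_colinear -tmap_comp; apply: eq_tmap.
Defined.

(** Stated for a given h rather than for a sum, so that it covers differences and
    opposites, whichever way they are written. *)
Lemma comod_sum_colinear X Y (a b : k) (f g : comod_hom X Y) (h : {linear X -> Y}) :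
  (forall x, h x = a *: f x + b *: g x) -> colinear h.
Proof.
move=> E x.
have Et (t : X ⊗ H) : tmap h idfun t = a *: tmap f idfun t + b *: tmap g idfun t.
  elim/tens_ind: t => [y z hy hz|y c].
    by rewrite !linearD hy hz addrACA.
  by rewrite !tmapE E tensDl !tensZl.
by rewrite E Et -!comod_hom_colinear linearD; congr (_ + _); apply: linearZ_LR.
Qed.

(** Reduces colinearity of a map that involves the antipode to that of its inverse,
    which does not. *)
Lemma colinear_inverse X Y (f : comod_hom X Y) (g : {linear Y -> X}) :
  cancel f g -> cancel g f -> colinear g.
Proof.
move=> fK gK y; rewrite -{2}[y]gK comod_hom_colinear -tmap_comp.
rewrite -[LHS]tmap_id; apply: eq_tmap => // x /=; exact/esym/fK.
Qed.

Definition comod_tmap X Y X' Y' (f : comod_hom X X') (g : comod_hom Y Y') :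
  comod_hom (tens_comod X Y) (tens_comod X' Y').
Proof.
exists (tmap f g).
elim/tens_ind=> [x y hx hy|x y]; first by rewrite !linearD hx hy.
rewrite tmapE !coact_tensE !comod_hom_colinear.
elim/tens_ind: (coact X x) => [u v hu hv|x' a].
  by rewrite tens2Dl !linearD tens2Dl hu hv.
elim/tens_ind: (coact Y y) => [u v hu hv|y' b].
  by rewrite tens2Dr !linearD tens2Dr hu hv.
by rewrite !tmapE !tens2E !tmapE.
Defined.

Lemma comod_tmapE X Y X' Y' (f : comod_hom X X') (g : comod_hom Y Y') x y :
  comod_tmap f g (x ⊗ₜ y) = f x ⊗ₜ g y.
Proof. exact: tmapE. Qed.

Lemma bilinear_colinear X Y Z (b : {bilinear X -> Y -> Z}) :
    (forall x y, coact Z (b x y) = tens2 b (@amul k H) (coact X x) (coact Y y)) ->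
  @colinear _ _ (tens_comod X Y) Z (tlift b).
Proof.
move=> E; elim/tens_ind=> [x y hx hy|x y]; first by rewrite !linearD hx hy.
rewrite coact_tensE (tmap_tens2 (c := b) _ _ _) => [|x' y']; last exact: tliftE.
by rewrite -E; congr (coact Z _); apply: tliftE.
Qed.

End ComodHom.

Section Trivial.
Variable V : lmodType k.

Let triv_fun (v : V) : V ⊗ H := v ⊗ₜ 1.
Let triv_lin : linear triv_fun.
Proof. by move=> a u v; rewrite /triv_fun tensDl tensZl. Qed.

Definition triv_coact : {linear V -> V ⊗ H} :=
  HB.pack triv_fun (GRing.isLinear.Build k V (V ⊗ H) *:%R triv_fun triv_lin).

Fact triv_coactA v :
  tassoc (tmap triv_coact idfun (triv_coact v)) = tmap idfun Δ (triv_coact v).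
Proof. by rewrite !tmapE tassocE /= comul1. Qed.

Fact triv_counit v : tcontr V ε (triv_coact v) = v.
Proof. by rewrite [LHS]tcontrE counit1 scale1r. Qed.

Definition triv_comod : comodule H := Comodule triv_coactA triv_counit.

(** V ⊗ H with the coaction v ⊗ h |-> v ⊗ h1 ⊗ h2, obtained as the diagonal
    coaction for the trivial comodule V. *)
Definition cofree : comodule H := tens_comod triv_comod (reg_comod H).

Lemma coact_cofree (t : V ⊗ H) : coact cofree t = tassocV (tmap idfun Δ t).
Proof.
elim/tens_ind: t => [x y hx hy|v h]; first by rewrite !linearD hx hy.
rewrite [LHS]coact_tensE tmapE /= /triv_fun.
elim/tens_ind: (Δ h) => [x y hx hy|a b].
  by rewrite tens2Dr tensDr linearD hx hy.
by rewrite tens2E tassocVE; congr (_ ⊗ₜ _); apply: mul1r.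
Qed.

Lemma coact_cofreeE (v : V) (h : H) : coact cofree (v ⊗ₜ h) = tassocV (v ⊗ₜ Δ h).
Proof. by rewrite coact_cofree tmapE. Qed.

(** The colinear map x |-> F x0 ⊗ x1 attached to a linear map F; the coaction of X
    is the case of the identity. *)
Lemma colinear_cofree X (F : {linear X -> V}) :
  @colinear _ _ X cofree (tmap F idfun \o coact X).
Proof.
move=> x; rewrite coact_cofree /= -tmap_comp.
have -> : tmap (tmap F idfun \o coact X) idfun (coact X x) =
    tassocV (tmap F idfun (tassoc (tmap (coact X) idfun (coact X x)))).
  elim/tens_ind: (coact X x) => [y z hy hz|y h]; first by rewrite !linearD hy hz.
  rewrite !tmapE /=; elim/tens_ind: (coact X y) => [u v hu hv|y' h'].
    by rewrite linearD !tensDl !linearD hu hv.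
  by rewrite tassocE !tmapE tassocVE.
by rewrite coactA -tmap_comp; congr (tassocV _); apply: eq_tmap.
Qed.

Definition cofree_hom X (F : {linear X -> V}) : comod_hom X cofree :=
  ComodHom (colinear_cofree F).

Definition tmulr : {linear (V ⊗ H) ⊗ H -> V ⊗ H} := tmap idfun mulH \o tassoc.

Definition tmulr_bil (t : V ⊗ H) (b : H) : V ⊗ H := tmulr (t ⊗ₜ b).

Fact tmulr_bil_lin : bilinear_for *:%R *:%R tmulr_bil.
Proof.
split=> [b c t u|t c a b]; rewrite /tmulr_bil; first by rewrite tensDl tensZl linearP.
by rewrite tensDr tensZr linearP.
Qed.

HB.instance Definition _ :=
  bilinear_isBilinear.Build k (V ⊗ H) H (V ⊗ H) *:%R *:%R tmulr_bil tmulr_bil_lin.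

Lemma tmulrE (v : V) (a b : H) : tmulr ((v ⊗ₜ a) ⊗ₜ b) = v ⊗ₜ (a * b).
Proof. by rewrite /tmulr /= tassocE tmapE mulHE. Qed.

End Trivial.

Arguments tmulr {V}.
Arguments tmulr_bil {V}.

Lemma tmulr_colinear X :
  @colinear _ _ (tens_comod (tens_comod X (reg_comod H)) (reg_comod H))
    (tens_comod X (reg_comod H)) tmulr.
Proof.
elim/tens_ind=> [x y hx hy|t b]; first by rewrite !linearD hx hy.
elim/tens_ind: t => [x y hx hy|x a]; first by rewrite tensDl !linearD hx hy.
have E : coact (reg_comod H) ((a : H) * b) = mul2 (Δ a) (Δ b) by apply: comulM.
rewrite tmulrE !coact_tensE E.
have mulA (c d e : H) : amul c (amul d e) = amul (amul c d) e by apply: mulrA.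
have -> (t : (X ⊗ H) ⊗ H) u : tmap tmulr idfun (tens2 tens (@amul k H) t u) =
    tens2 tmulr_bil (@amul k H) t u.
  by apply: tmap_tens2 => y c.
by apply: tens2A => // y c d; apply/esym/tmulrE.
Qed.

Section Twist.
Variable X : comodule H.

(** x ⊗ h |-> x0 ⊗ S(x1) h, the inverse of [untwist]. *)
Definition twist_fun : {linear X ⊗ H -> X ⊗ H} :=
  tmulr \o tmap (tmap idfun S \o coact X) idfun.

Lemma twistE (x : X) (h : H) : twist_fun (x ⊗ₜ h) = tmulr (tmap idfun S (coact X x) ⊗ₜ h).
Proof. by rewrite /twist_fun /= tmapE. Qed.

(** x ⊗ h |-> x0 ⊗ x1 h identifies the diagonal coaction on X ⊗ H with the
    cofree one. *)
Definition untwist : comod_hom (tens_comod X (reg_comod H)) (cofree X) :=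
  comod_comp (ComodHom (tmulr_colinear (X := triv_comod X)))
    (comod_tmap (cofree_hom idfun) (comod_id (reg_comod H))).

Lemma untwistE (x : X) (h : H) : untwist (x ⊗ₜ h) = tmulr (coact X x ⊗ₜ h).
Proof.
rewrite [LHS](_ : _ = tmulr (comod_tmap (cofree_hom idfun) (comod_id (reg_comod H)) (x ⊗ₜ h))) //.
by rewrite comod_tmapE; congr (tmulr (_ ⊗ₜ _)); apply: tmap_id.
Qed.

(** x0 ⊗ S(x1) x2 h = x ⊗ h. *)
Lemma twist_untwistK : cancel untwist twist_fun.
Proof.
elim/tens_ind=> [x y hx hy|x h]; first by rewrite !linearD hx hy.
have E (t : X ⊗ H) : twist_fun (tmulr (t ⊗ₜ h)) =
    tmulr (tmap idfun mulSl (tassoc (tmap (coact X) idfun t)) ⊗ₜ h).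
  elim/tens_ind: t => [y z hy hz|y a]; first by rewrite !(tensDl, linearD) hy hz.
  rewrite tmulrE tmapE twistE.
  elim/tens_ind: (coact X y) => [u v hu hv|y' b]; first by rewrite !(tensDl, linearD) hu hv.
  by rewrite tassocE !tmapE !tmulrE mulSlE mulrA.
rewrite untwistE E coactA -tmap_comp -[x in RHS]coact_counit.
elim/tens_ind: (coact X x) => [u v hu hv|y a]; first by rewrite !(tensDl, linearD) hu hv.
rewrite tmapE tcontrE tmulrE tensZl -tensZr; congr (_ ⊗ₜ _).
have: mulSl (Δ a) * h = (ε a : k) *: h by rewrite mulSl_comul mulr_algl.
exact.
Qed.

(** x0 ⊗ x1 S(x2) h = x ⊗ h. *)
Lemma untwist_twistK : cancel twist_fun untwist.
Proof.
elim/tens_ind=> [x y hx hy|x h]; first by rewrite !linearD hx hy.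
have E (t : X ⊗ H) : untwist (tmulr (tmap idfun S t ⊗ₜ h)) =
    tmulr (tmap idfun mulSr (tassoc (tmap (coact X) idfun t)) ⊗ₜ h).
  elim/tens_ind: t => [y z hy hz|y a]; first by rewrite !(tensDl, linearD) hy hz.
  rewrite !tmapE tmulrE untwistE.
  elim/tens_ind: (coact X y) => [u v hu hv|y' b]; first by rewrite !(tensDl, linearD) hu hv.
  by rewrite tassocE !tmapE !tmulrE mulSrE mulrA.
rewrite twistE E coactA -tmap_comp -[x in RHS]coact_counit.
elim/tens_ind: (coact X x) => [u v hu hv|y a]; first by rewrite !(tensDl, linearD) hu hv.
rewrite tmapE tcontrE tmulrE tensZl -tensZr; congr (_ ⊗ₜ _).
have: mulSr (Δ a) * h = (ε a : k) *: h by rewrite mulSr_comul mulr_algl.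
exact.
Qed.

Definition twist : comod_hom (cofree X) (tens_comod X (reg_comod H)) :=
  ComodHom (colinear_inverse twist_untwistK untwist_twistK).

End Twist.
End Comod.

Arguments tmulr {k H V}.
Arguments mulSl {k H}.
Arguments mulSr {k H}.
Arguments mulH {k H}.

(** * Injective comodules *)

Section Injective.
Variables (k : fieldType) (H : hopfAlgType k).
Implicit Types X Y Z I L N : comodule H.
Local Notation Δ := (comul H).
Local Notation S := (antipode H).
Local Notation ε := (counit H).
Local Notation mul2 := (tens2 (@amul k H) (@amul k H)).
Local Notation reg := (reg_comod H).
Local Notation mull a := ((@amul k H : {bilinear H -> H -> H}) a).

Definition unit_hom X : comod_hom X (tens_comod X reg).
Proof.
exists (triv_coact H X) => x; rewrite [LHS]coact_tensE [comul H 1]comul1.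
elim/tens_ind: (coact X x) => [u v hu hv|y a].
  by rewrite tens2Dl linearD hu hv.
by rewrite tens2E tmapE; congr (_ ⊗ₜ _); apply: mulr1.
Defined.

(** A colinear left inverse of x |-> x ⊗ 1 : X -> X ⊗ H. Its existence is equivalent
    to injectivity of X, and it is the form of injectivity that can be imposed
    freely by generators and relations. *)
Definition absorbing X (r : comod_hom (tens_comod X reg) X) :=
  forall x : X, r (x ⊗ₜ 1) = x.

Lemma twist_coact X (x : X) : twist X (coact X x) = x ⊗ₜ 1.
Proof.
rewrite -[RHS](@twist_untwistK _ _ X) untwistE; congr (twist X _).
elim/tens_ind: (coact X x) => [u v hu hv|y a].
  by rewrite tensDl linearD -hu -hv.
by rewrite tmulrE mulr1.
Qed.

(** Extend f : Y -> X linearly along i to a map on Z, make it colinear as a map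
    Z -> X_triv ⊗ H, untwist, and absorb. On Y this gives y |-> r (f y ⊗ 1) = f y. *)
Lemma absorbing_injective X (r : comod_hom (tens_comod X reg) X) :
  absorbing r -> injective_comodule X.
Proof.
move=> r1 Y Z i f /linear_retraction[p ip].
exists (comod_comp r (comod_comp (twist X) (cofree_hom (f \o p : {linear Z -> X})))) => y.
rewrite [LHS](_ : _ = r (twist X (tmap (f \o p : {linear Z -> X}) idfun (coact Z (i y))))) //.
rewrite comod_hom_colinear -tmap_comp.
rewrite (@eq_tmap _ _ _ _ _ _ f _ idfun) => [|y'|//]; last by rewrite /= ip.
by rewrite -comod_hom_colinear twist_coact r1.
Qed.

Lemma injective_absorbing X : injective_comodule X ->
  exists r : comod_hom (tens_comod X reg) X, absorbing r.
Proof.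
move=> injX; have [|r rP] := injX _ _ (unit_hom X) (comod_id X); last by exists r.
apply: (@can_inj _ _ _ (tcontr X ε)) => x.
by rewrite [LHS]tcontrE counit1 scale1r.
Qed.

Lemma injective_coact X : injective_comodule X ->
  exists r : comod_hom (cofree H X) X, forall x, r (coact X x) = x.
Proof.
move=> injX.
have [|r rP] := injX _ _ (cofree_hom (X := X) idfun) (comod_id X).
  apply: (@can_inj _ _ _ (tcontr X ε)) => x.
  by rewrite [cofree_hom _ _]tmap_id coact_counit.
by exists r => x; rewrite -[RHS]rP; congr (r _); rewrite -[LHS]tmap_id.
Qed.

Lemma injective_retract X Y (i : comod_hom X Y) (p : comod_hom Y X) :
  cancel i p -> injective_comodule Y -> injective_comodule X.
Proof.
move=> ip injY Z T j f jinj; have [g gP] := injY _ _ j (comod_comp i f) jinj.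
by exists (comod_comp p g) => x; rewrite /= gP /= ip.
Qed.

(** * The integral and projectivity of injective comodules *)

Section Integral.
Variable Lam : left_integral H.

Let mul2l : {linear (H ⊗ H) ⊗ (H ⊗ H) -> H ⊗ H} := tlift mul2.
Let inr1 : {linear H -> H ⊗ H} := (tens : {bilinear H -> H -> H ⊗ H}) 1.
(* Ls (a ⊗ b) = Δ(a) (1 ⊗ S b) and Ms (a ⊗ b) = Δ(S a) (b ⊗ 1). *)
Let Ls : {linear H ⊗ H -> H ⊗ H} := mul2l \o tmap Δ (inr1 \o S).
Let Ms : {linear H ⊗ H -> H ⊗ H} := mul2l \o tmap (Δ \o S) (triv_coact H H).

Let LsE a b : Ls (a ⊗ₜ b) = mul2 (Δ a) (1 ⊗ₜ S b).
Proof. by rewrite [LHS](_ : _ = mul2l (tmap Δ (inr1 \o S) (a ⊗ₜ b))) // tmapE [LHS]tliftE. Qed.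

Let MsE a b : Ms (a ⊗ₜ b) = mul2 (Δ (S a)) (b ⊗ₜ 1).
Proof.
rewrite [LHS](_ : _ = mul2l (tmap (Δ \o S) (triv_coact H H) (a ⊗ₜ b))) // tmapE.
by rewrite [LHS]tliftE.
Qed.

Let mul2A x y z : mul2 x (mul2 y z) = mul2 (mul2 x y) z.
Proof. by apply: tens2A => a b c; apply: mulrA. Qed.

Let Ls_comul b : Ls (Δ b) = b ⊗ₜ 1.
Proof.
have E (t : H ⊗ H) : Ls t = tmap idfun mulSr (tassoc (tmap Δ idfun t)).
  elim/tens_ind: t => [u v hu hv|p q]; first by rewrite !linearD hu hv.
  rewrite LsE tmapE; elim/tens_ind: (Δ p) => [u v hu hv|a a'].
    by rewrite tens2Dl tensDl !linearD hu hv.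
  by rewrite tassocE tmapE tens2E mulSrE; congr (_ ⊗ₜ _); apply: mulr1.
rewrite E comulA -tmap_comp -[in RHS](comul_counitr b).
elim/tens_ind: (Δ b) => [u v hu hv|p q]; first by rewrite !linearD hu hv tensDl.
rewrite tmapE tcontrE tensZl -tensZr; congr (_ ⊗ₜ _).
exact: mulSr_comul.
Qed.

Let Ms_comul b : Ms (Δ b) = 1 ⊗ₜ S b.
Proof.
have E1 (t : H ⊗ H) : Ms t = mul2l (tmap (Δ \o S) Ls (tmap idfun Δ t)).
  elim/tens_ind: t => [u v hu hv|p q]; first by rewrite !linearD hu hv.
  by rewrite !tmapE Ls_comul MsE [RHS]tliftE.
have E2 t : mul2l (tmap (Δ \o S) Ls (tassoc t)) = Ls (tmap mulSl idfun t).
  elim/tens_ind: t => [u v hu hv|z y]; first by rewrite !linearD hu hv.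
  elim/tens_ind: z => [u v hu hv|p q]; first by rewrite tensDl !linearD hu hv.
  by rewrite tassocE !tmapE mulSlE !LsE comulM -mul2A [LHS]tliftE.
rewrite E1 -comulA E2 -tmap_comp -{2}[b]comul_counitl.
elim/tens_ind: (Δ b) => [u v hu hv|p q]; first by rewrite !linearD hu hv tensDr.
rewrite tmapE tcontlE linearZ_LR tensZr.
rewrite [X in Ls (X ⊗ₜ _)](mulSl_comul p) tensZl linearZ_LR LsE comul1 tens2E.
by congr (_ *: (_ ⊗ₜ _)); apply: mul1r.
Qed.

Let tcontr_mul2 z (b : H) :
  tcontr H Lam (mul2 z (b ⊗ₜ 1)) = tcontr H Lam z * b.
Proof.
elim/tens_ind: z => [u v hu hv|p q].
  by rewrite tens2Dl !linearD hu hv mulrDl.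
rewrite tens2E !tcontrE -scalerAl; congr ((Lam _ : k) *: _).
exact: mulr1.
Qed.

(** a1 Λ(a2 S(b)) = Λ(a S(b1)) b2. Writing 1 ⊗ S(b) as Δ(S(b1)) (b2 ⊗ 1) turns the
    left-hand side into (id ⊗ Λ)(Δ(a S(b1))) b2, to which the defining property of
    the integral applies. *)
Lemma integral_shift (a b : H) :
  tcontr H Lam (mul2 (Δ a) (1 ⊗ₜ S b)) =
  tcontl H Lam (mul2 (a ⊗ₜ 1) (tmap S idfun (Δ b))).
Proof.
rewrite -Ms_comul; elim/tens_ind: (Δ b) => [u v hu hv|p q].
  by rewrite linearD tens2Dr !linearD tens2Dr linearD hu hv.
rewrite MsE mul2A tmapE tens2E -comulM tcontr_mul2 left_integralP tcontlE.
by rewrite mulr_algl; congr (_ *: _); apply/esym/mul1r.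
Qed.

(** l ⊗ b |-> l0 Λ(l1 S(b)): it sends the map x |-> F x0 ⊗ x1 attached to a linear
    F : X -> L to a colinear map X -> L, as averaging over a group does. *)
Definition average_fun L : {linear L ⊗ H -> L} :=
  tcontr L Lam \o tmulr \o tmap (coact L) S.

Lemma average_funE L (l : L) (b : H) :
  average_fun L (l ⊗ₜ b) = tcontr L Lam (tmulr (coact L l ⊗ₜ S b)).
Proof. by rewrite [LHS](_ : _ = tcontr L Lam (tmulr (tmap (coact L) S (l ⊗ₜ b)))) // tmapE. Qed.

Lemma average_colinear L : @colinear _ _ (cofree H L) L (average_fun L).
Proof.
elim/tens_ind=> [x y hx hy|l b]; first by rewrite !linearD hx hy.
pose κ : {linear H ⊗ H -> H} := tcontr H Lam \o bil_r mul2 (1 ⊗ₜ S b).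
have El (t : L ⊗ H) : coact L (tcontr L Lam (tmulr (t ⊗ₜ S b))) =
    tmap idfun κ (tassoc (tmap (coact L) idfun t)).
  elim/tens_ind: t => [x y hx hy|l' a].
    by rewrite tensDl !linearD hx hy.
  rewrite tmulrE tcontrE linearZ_LR tmapE.
  elim/tens_ind: (coact L l') => [x y hx hy|l'' a'].
    by rewrite scalerDr hx hy tensDl !linearD.
  rewrite tassocE tmapE -tensZr; congr (_ ⊗ₜ _).
  rewrite [RHS](_ : _ = tcontr H Lam (mul2 (a' ⊗ₜ a) (1 ⊗ₜ S b))) // tens2E tcontrE.
  by congr (_ *: _); apply/esym/mulr1.
pose κ' w : {linear H -> H} :=
  tcontl H Lam \o bil_r mul2 (tmap S idfun w) \o triv_coact H H.
have κ'E w a : κ' w a = tcontl H Lam (mul2 (a ⊗ₜ 1) (tmap S idfun w)) by [].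
have Er w : tmap (average_fun L) idfun (tassocV (l ⊗ₜ w)) = tmap idfun (κ' w) (coact L l).
  elim/tens_ind: w => [u v hu hv|b1 b2].
    rewrite (@tmapDr _ _ _ _ (κ' u) (κ' v)) => [|a].
      by rewrite tensDr !linearD hu hv.
    by rewrite !κ'E linearD tens2Dr linearD.
  rewrite tassocVE tmapE average_funE.
  elim/tens_ind: (coact L l) => [u v hu hv|l' a].
    by rewrite tensDl !linearD tensDl hu hv.
  rewrite tmulrE tcontrE tmapE κ'E tmapE tens2E tcontlE tensZr -tensZl.
  by congr (_ ⊗ₜ _); apply/esym/mul1r.
rewrite coact_cofreeE Er average_funE El coactA -tmap_comp.
by apply: eq_tmap => // a; rewrite [LHS]integral_shift.
Qed.

Definition average L : comod_hom (cofree H L) L := ComodHom (average_colinear (L := L)).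

Lemma average_natural L N (f : comod_hom L N) (t : L ⊗ H) :
  f (average L t) = average N (tmap f idfun t).
Proof.
elim/tens_ind: t => [x y hx hy|l b]; first by rewrite !linearD hx hy.
rewrite tmapE ![average _ _]average_funE comod_hom_colinear.
elim/tens_ind: (coact L l) => [u v hu hv|l' a].
  by rewrite linearD !tensDl !linearD hu hv.
by rewrite tmapE !tmulrE !tcontrE linearZ_LR.
Qed.

(** v ⊗ a1 h1 Λ(a2 h2 S(h3)) = Λ(a) v ⊗ h: multiplying by a on the left before
    averaging recovers the identity of a cofree comodule, even when Λ(1) = 0. *)
Lemma average_mull (V : lmodType k) (a h : H) (v : V) : Lam a = 1 ->
  average (cofree H V) (tmap (tmap idfun (mull a)) idfun (tassocV (v ⊗ₜ Δ h))) = v ⊗ₜ h.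
Proof.
move=> Lam_a.
have E w : average (cofree H V) (tmap (tmap idfun (mull a)) idfun (tassocV (v ⊗ₜ w))) =
    v ⊗ₜ tcontr H Lam (mul2 (Δ a) (Ls w)).
  elim/tens_ind: w => [u w hu hw|b1 b2].
    by rewrite tensDr !linearD hu hw tens2Dr linearD tensDr.
  rewrite tassocVE !tmapE LsE mul2A -comulM [LHS]average_funE coact_cofreeE.
  elim/tens_ind: (Δ _) => [u w hu hw|c d].
    by rewrite tens2Dl !(tensDl, tensDr, linearD) hu hw.
  rewrite tassocVE tens2E tmulrE !tcontrE -tensZr; congr (_ ⊗ₜ (_ *: _)).
  exact/esym/mulr1.
by rewrite E Ls_comul tcontr_mul2 left_integralP Lam_a scale1r mul1r.
Qed.

(** Injective comodules are projective. With s a linear section of f, r a colinear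
    retraction of the coaction of I and Λ(a) = 1, the lift of v is the average of
    x |-> s (v (r (x0 ⊗ a x1))). *)
Lemma injective_lift I L N (f : comod_hom L N) (v : comod_hom I N) :
    (exists h, Lam h <> 0) -> injective_comodule I -> (forall n, exists l, f l = n) ->
  exists u : comod_hom I L, forall x, f (u x) = v x.
Proof.
move=> [h /eqP Lam_h] /injective_coact[r rK] /linear_section[s sK].
pose a : H := (Lam h : k)^-1 *: h.
have Lam_a : Lam a = 1 by rewrite /a linearZ; apply: mulVf.
pose m : {linear I -> I ⊗ H} := tmap idfun (mull a) \o coact I.
pose F : {linear I -> L} := s \o v \o r \o m.
exists (comod_comp (average L) (cofree_hom F)) => x.
rewrite [LHS](_ : _ = f (average L (tmap F idfun (coact I x)))) //.
rewrite average_natural -tmap_comp.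
rewrite (@eq_tmap _ _ _ _ _ _ (comod_comp v r \o m) _ idfun) => [|y|//]; last exact: sK.
rewrite (@eq_tmap _ _ _ _ _ _ _ _ (idfun \o idfun) (fun=> erefl) (fun=> erefl)).
rewrite tmap_comp -average_natural -[x in RHS]rK; congr (v (r _)).
rewrite -[in RHS](tmap_id (coact I x)) -{2}[coact I x]tmap_id.
have -> : tmap m idfun (coact I x) =
    tmap (tmap idfun (mull a)) idfun (tassocV (tmap idfun Δ (coact I x))).
  rewrite -coactA tassocK -tmap_comp; exact: eq_tmap.
elim/tens_ind: (coact I x) => [y z hy hz|y b]; first by rewrite !linearD hy hz.
by rewrite !tmapE average_mull.
Qed.

Section StableEquivalence.
Variables (L N : comodule H) (f : comod_hom L N).
Hypotheses (Lam_neq0 : exists h, Lam h <> 0) (f_surj : forall n, exists l, f l = n).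
Hypothesis f_stable : stable_equivalence f.

(** If f g - 1 factors through an injective comodule, the second factor lifts
    along f, and this corrects the stable inverse g to a section. *)
Lemma stable_equivalence_section : exists s : comod_hom N L, cancel s f.
Proof.
have [g [_ [I [u [v [injI fg]]]]]] := f_stable.
have [w wP] := injective_lift v Lam_neq0 injI f_surj.
pose s : {linear N -> L} := g \- (w \o u).
have s_col : colinear s.
  apply: (@comod_sum_colinear _ _ _ _ 1 (-1) g (comod_comp w u)) => x.
  by rewrite scale1r scaleN1r.
exists (ComodHom s_col) => n /=.
by rewrite linearB /= wP -fg opprB addrC subrK.
Qed.

(** On the kernel, g f - 1 is minus the identity and factors through an injective
    comodule, of which the kernel is therefore a retract. *)
Lemma stable_equivalence_kernel K (i : comod_hom K L) (r : comod_hom L K) :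
  cancel i r -> (forall x, f (i x) = 0) -> injective_comodule K.
Proof.
have [g [[I [u [v [injI gf]]]] _]] := f_stable => ir fi0.
pose p : {linear I -> K} := \- (r \o v).
have p_col : colinear p.
  apply: (@comod_sum_colinear _ _ _ _ 0 (-1) (comod_comp r v) (comod_comp r v)) => x.
  by rewrite scale0r add0r scaleN1r.
apply: (@injective_retract K I (comod_comp u i) (ComodHom p_col)) => // x /=.
by rewrite -gf /= fi0 linear0 sub0r linearN opprK ir.
Qed.

End StableEquivalence.
End Integral.

End Injective.

(** * The free absorbing A-module on M *)

Section FreeAbsorbing.
Variables (k : fieldType) (H : hopfAlgType k) (A : comodAlg H).

(** What remains of an object of LMod_A(M^H) with an absorbing map X ⊗ H -> X when
    the coaction is forgotten. The coaction of the free object is itself obtained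
    from the universal property among these. *)
Record absmod := AbsMod {
  am_mod :> lmodType k;
  am_act : {bilinear A -> am_mod -> am_mod};
  am_abs : {bilinear am_mod -> H -> am_mod};
  am_act1 : forall x, am_act (ca_one A) x = x;
  am_actA : forall a b x, am_act a (am_act b x) = am_act (ca_mul A a b) x;
  am_abs1 : forall x, am_abs x 1 = x
}.

Section Free.
Variable M : lmodComod A.

Definition act_compatible (X : absmod) (f : {linear M -> X}) :=
  forall a m, f (lc_act M a m) = am_act X a (f m).

Inductive aterm :=
| TGen (m : M)
| TAdd (s t : aterm)
| TScale (c : k) (s : aterm)
| TAct (a : A) (s : aterm)
| TAbs (s : aterm) (h : H).

HB.instance Definition _ := gen_eqMixin aterm.
HB.instance Definition _ := gen_choiceMixin aterm.

Section Interp.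
Variables (X : absmod) (f : {linear M -> X}).

Fixpoint interp (t : aterm) : X :=
  match t with
  | TGen m => f m
  | TAdd s t => interp s + interp t
  | TScale c s => c *: interp s
  | TAct a s => am_act X a (interp s)
  | TAbs s h => am_abs X (interp s) h
  end.

End Interp.

(** Terms are identified when they agree in every model; this relation contains
    every consequence of the axioms without listing them, and the universal
    property is immediate. *)
Definition arel (s t : aterm) : Prop :=
  forall (X : absmod) (f : {linear M -> X}), act_compatible f -> interp f s = interp f t.

Definition arelb : rel aterm := fun s t => `[< arel s t >].

Fact arelb_refl : reflexive arelb.
Proof. by move=> s; apply/asboolP. Qed.

Fact arelb_sym : symmetric arelb.
Proof. by move=> s t; apply/asboolP/asboolP => st X f fA; rewrite (st X f fA). Qed.

Fact arelb_trans : transitive arelb.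
Proof.
move=> t s u /asboolP st /asboolP tu; apply/asboolP => X f fA.
by rewrite (st X f fA) (tu X f fA).
Qed.

Canonical aequiv := EquivRel arelb arelb_refl arelb_sym arelb_trans.

Local Open Scope quotient_scope.

Definition free_mod := {eq_quot aequiv}.

HB.instance Definition _ := Choice.on free_mod.

Definition free_cls (t : aterm) : free_mod := \pi_{eq_quot aequiv} t.

Definition free_ev (X : absmod) (f : {linear M -> X}) (x : free_mod) : X := interp f (repr x).

Lemma free_ev_cls (X : absmod) (f : {linear M -> X}) t : act_compatible f ->
  free_ev f (free_cls t) = interp f t.
Proof.
move=> fA; rewrite /free_ev.
have /eqquotP/asboolP : repr (free_cls t) = t %[mod {eq_quot aequiv}] by rewrite reprK.
exact.
Qed.

(** All the identities of a model hold in the free one for this reason. *)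
Lemma free_separated (x y : free_mod) :
    (forall (X : absmod) (f : {linear M -> X}), act_compatible f -> free_ev f x = free_ev f y) ->
  x = y.
Proof.
move=> xy; rewrite -[x]reprK -[y]reprK; apply/eqquotP/asboolP => X f fA.
exact: xy.
Qed.

Definition free_add (x y : free_mod) := free_cls (TAdd (repr x) (repr y)).
Definition free_scale c (x : free_mod) := free_cls (TScale c (repr x)).
Definition free_act a (x : free_mod) := free_cls (TAct a (repr x)).
Definition free_abs (x : free_mod) h := free_cls (TAbs (repr x) h).
Definition free_gen m := free_cls (TGen m).
Definition free_zero := free_gen 0.
Definition free_opp := free_scale (-1).

Section Ev.
Variables (X : absmod) (f : {linear M -> X}).
Hypothesis fA : act_compatible f.

Lemma free_ev_gen m : free_ev f (free_gen m) = f m. Proof. exact: free_ev_cls. Qed.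
Lemma free_ev_zero : free_ev f free_zero = 0. Proof. by rewrite free_ev_gen linear0. Qed.
Lemma free_ev_add x y : free_ev f (free_add x y) = free_ev f x + free_ev f y.
Proof. exact: free_ev_cls. Qed.
Lemma free_ev_scale c x : free_ev f (free_scale c x) = c *: free_ev f x.
Proof. exact: free_ev_cls. Qed.
Lemma free_ev_opp x : free_ev f (free_opp x) = - free_ev f x.
Proof. by rewrite free_ev_scale scaleN1r. Qed.
Lemma free_ev_act a x : free_ev f (free_act a x) = am_act X a (free_ev f x).
Proof. exact: free_ev_cls. Qed.
Lemma free_ev_abs x h : free_ev f (free_abs x h) = am_abs X (free_ev f x) h.
Proof. exact: free_ev_cls. Qed.

Definition free_evE :=
  (free_ev_gen, free_ev_zero, free_ev_add, free_ev_scale, free_ev_opp, free_ev_act, free_ev_abs).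

End Ev.

Fact free_addA : associative free_add.
Proof. by move=> x y z; apply: free_separated => X f fA; rewrite !(free_evE fA) addrA. Qed.
Fact free_addC : commutative free_add.
Proof. by move=> x y; apply: free_separated => X f fA; rewrite !(free_evE fA) addrC. Qed.
Fact free_add0 : left_id free_zero free_add.
Proof. by move=> x; apply: free_separated => X f fA; rewrite !(free_evE fA) add0r. Qed.
Fact free_addN : left_inverse free_zero free_opp free_add.
Proof. by move=> x; apply: free_separated => X f fA; rewrite !(free_evE fA) addNr. Qed.

HB.instance Definition _ := GRing.isZmodule.Build free_mod free_addA free_addC free_add0 free_addN.

Fact free_scaleA a b x : free_scale a (free_scale b x) = free_scale (a * b) x.
Proof. by apply: free_separated => X f fA; rewrite !(free_evE fA) scalerA. Qed.
Fact free_scale1 : left_id 1 free_scale.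
Proof. by move=> x; apply: free_separated => X f fA; rewrite !(free_evE fA) scale1r. Qed.
Fact free_scaleDr : right_distributive free_scale +%R.
Proof. by move=> a x y; apply: free_separated => X f fA; rewrite !(free_evE fA) scalerDr. Qed.
Fact free_scaleDl x : {morph free_scale^~ x : a b / a + b}.
Proof. by move=> a b; apply: free_separated => X f fA; rewrite !(free_evE fA) scalerDl. Qed.

HB.instance Definition _ :=
  GRing.Zmodule_isLmodule.Build k free_mod free_scaleA free_scale1 free_scaleDr free_scaleDl.

Fact free_act_bilinear : bilinear_for *:%R *:%R free_act.
Proof.
split=> [x c a b|a c x y]; apply: free_separated => X f fA /=; rewrite !(free_evE fA).
  exact: linearPl.
exact: linearPr.
Qed.

HB.instance Definition _ :=
  bilinear_isBilinear.Build k A free_mod free_mod *:%R *:%R free_act free_act_bilinear.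

Fact free_abs_bilinear : bilinear_for *:%R *:%R free_abs.
Proof.
split=> [h c x y|x c g h]; apply: free_separated => X f fA /=; rewrite !(free_evE fA).
  exact: linearPl.
exact: linearPr.
Qed.

HB.instance Definition _ :=
  bilinear_isBilinear.Build k free_mod H free_mod *:%R *:%R free_abs free_abs_bilinear.

Fact free_gen_linear : linear free_gen.
Proof. by move=> c m n; apply: free_separated => X f fA; rewrite !(free_evE fA) linearP. Qed.

HB.instance Definition _ := GRing.isLinear.Build k M free_mod *:%R free_gen free_gen_linear.

Fact free_ev_linear (X : absmod) (f : {linear M -> X}) : act_compatible f -> linear (free_ev f).
Proof. by move=> fA c x y; rewrite !(free_evE fA). Qed.

Definition free_evl (X : absmod) (f : {linear M -> X}) (fA : act_compatible f) :
    {linear free_mod -> X} :=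
  HB.pack (free_ev f) (GRing.isLinear.Build k free_mod X *:%R (free_ev f) (free_ev_linear fA)).

Fact free_act1 x : free_act (ca_one A) x = x.
Proof. by apply: free_separated => X f fA; rewrite !(free_evE fA) am_act1. Qed.
Fact free_actA a b x : free_act a (free_act b x) = free_act (ca_mul A a b) x.
Proof. by apply: free_separated => X f fA; rewrite !(free_evE fA) am_actA. Qed.
Lemma free_abs1 x : free_abs x 1 = x.
Proof. by apply: free_separated => X f fA; rewrite !(free_evE fA) am_abs1. Qed.
Lemma free_gen_act a m : free_gen (lc_act M a m) = free_act a (free_gen m).
Proof. by apply: free_separated => X f fA; rewrite !(free_evE fA) fA. Qed.

Definition free_absmod : absmod := AbsMod free_act1 free_actA free_abs1.

Lemma free_ind (P : free_mod -> Prop) :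
    (forall m, P (free_gen m)) -> (forall c x y, P x -> P y -> P (c *: x + y)) ->
    (forall a x, P x -> P (free_act a x)) -> (forall x h, P x -> P (free_abs x h)) ->
  forall x, P x.
Proof.
move=> Pgen Plin Pact Pabs x; suff Pcls t : P (free_cls t) by rewrite -[x]reprK; apply: Pcls.
have P0 : P 0 by apply: Pgen.
have E t' : [/\ forall s, free_cls (TAdd s t') = free_cls s + free_cls t',
   forall c, free_cls (TScale c t') = c *: free_cls t',
   forall a, free_cls (TAct a t') = free_act a (free_cls t') &
   forall h, free_cls (TAbs t' h) = free_abs (free_cls t') h].
  by split=> *; apply: free_separated => X f fA; rewrite !(free_evE fA) !(free_ev_cls _ fA).
elim: t => [m|s Ps t Pt|c t Pt|a t Pt|t Pt h].
- exact: Pgen.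
- by case: (E t) => + _ _ _ => ->; rewrite -[free_cls s]scale1r; apply: Plin.
- by case: (E t) => _ + _ _ => ->; rewrite -[_ *: _]addr0; apply: Plin.
- by case: (E t) => _ _ + _ => ->; apply: Pact.
- by case: (E t) => _ _ _ => ->; apply: Pabs.
Qed.

End Free.
End FreeAbsorbing.

Arguments free_gen {k H A M} m.
Arguments free_act {k H A M} a x.
Arguments free_abs {k H A M} x h.

(** * The coaction on the free absorbing module *)

Section FreeComodule.
Variables (k : fieldType) (H : hopfAlgType k) (A : comodAlg H).
Local Notation Δ := (comul H).
Local Notation ε := (counit H).
Local Notation reg := (reg_comod H).

Section TensorAbsmod.
Variable X : absmod A.

(** If X is a model then so is X ⊗ H, with a (x ⊗ h) = a0 x ⊗ a1 h and
    (x ⊗ h) g = x g1 ⊗ h g2. A colinear structure on X is one for which the coaction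
    X -> X ⊗ H is a morphism of models. *)
Definition tens_act (a : A) (t : X ⊗ H) : X ⊗ H := tens2 (am_act X) (@amul k H) (coact A a) t.
Definition tens_abs (t : X ⊗ H) (h : H) : X ⊗ H := tens2 (am_abs X) (@amul k H) t (Δ h).

Fact tens_act_bilinear : bilinear_for *:%R *:%R tens_act.
Proof.
split=> [t c a b|a c t u]; rewrite /tens_act; last exact: linearPr.
by rewrite linearP tens2Dl tens2Zl.
Qed.

HB.instance Definition _ :=
  bilinear_isBilinear.Build k A (X ⊗ H) (X ⊗ H) *:%R *:%R tens_act tens_act_bilinear.

Fact tens_abs_bilinear : bilinear_for *:%R *:%R tens_abs.
Proof.
split=> [h c t u|t c g h]; rewrite /tens_abs; first exact: linearPl.
by rewrite linearP tens2Dr tens2Zr.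
Qed.

HB.instance Definition _ :=
  bilinear_isBilinear.Build k (X ⊗ H) H (X ⊗ H) *:%R *:%R tens_abs tens_abs_bilinear.

Fact tens_act1 t : tens_act (ca_one A) t = t.
Proof.
rewrite /tens_act ca_one_coact; elim/tens_ind: t => [u v hu hv|x h].
  by rewrite tens2Dr hu hv.
by rewrite tens2E am_act1; congr (_ ⊗ₜ _); apply: mul1r.
Qed.

Lemma ca_mul_coact a b :
  coact A (ca_mul A a b) = tens2 (ca_mul A) (@amul k H) (coact A a) (coact A b).
Proof.
have := ca_mul_colinear (a ⊗ₜ b); rewrite /= tliftE => ->.
by rewrite tens_coactE; apply: tmap_tens2 => x y; apply: tliftE.
Qed.

Fact tens_actA a b t : tens_act a (tens_act b t) = tens_act (ca_mul A a b) t.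
Proof.
rewrite /tens_act ca_mul_coact.
have mulA x y z : @amul k H x (amul y z) = amul (amul x y) z by apply: mulrA.
exact: (tens2A (@am_actA _ _ _ X) mulA).
Qed.

Fact tens_abs1 t : tens_abs t 1 = t.
Proof.
rewrite /tens_abs comul1; elim/tens_ind: t => [u v hu hv|x h].
  by rewrite tens2Dl hu hv.
by rewrite tens2E am_abs1; congr (_ ⊗ₜ _); apply: mulr1.
Qed.

Definition tensor_absmod : absmod A := AbsMod tens_act1 tens_actA tens_abs1.

End TensorAbsmod.

Section Coaction.
Variable M : lmodComod A.
Local Notation aM := (free_absmod M).
Local Notation gen := (free_gen : {linear M -> free_mod M}).

Let gen_coact : {linear M -> tensor_absmod aM} := tmap gen idfun \o coact M.

Fact gen_coact_compatible : act_compatible gen_coact.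
Proof.
move=> a m; rewrite [LHS](_ : _ = tmap gen idfun (coact M (lc_act M a m))) //.
rewrite lc_act_coact [RHS](_ : _ = tens_act (X := aM) a (tmap gen idfun (coact M m))) // /tens_act.
elim/tens_ind: (coact A a) => [u v hu hv|b g].
  by rewrite !(tens2Dl, linearD) hu hv.
elim/tens_ind: (coact M m) => [u v hu hv|n h].
  by rewrite !(tens2Dr, linearD) hu hv.
rewrite !(tmapE, tens2E); congr (_ ⊗ₜ _).
by rewrite -[RHS]/(free_act b (free_gen n)) -free_gen_act; congr (free_gen _); apply: tliftE.
Qed.

Definition free_coact : {linear free_mod M -> free_mod M ⊗ H} := free_evl gen_coact_compatible.

Lemma free_coact_gen m : free_coact (free_gen m) = tmap gen idfun (coact M m).
Proof. exact: (free_ev_gen gen_coact_compatible). Qed.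

Lemma free_coact_act a x :
  free_coact (free_act a x) = tens2 (am_act aM) (@amul k H) (coact A a) (free_coact x).
Proof. exact: (free_ev_act gen_coact_compatible). Qed.

Lemma free_coact_abs x h :
  free_coact (free_abs x h) = tens2 (am_abs aM) (@amul k H) (free_coact x) (Δ h).
Proof. exact: (free_ev_abs gen_coact_compatible). Qed.

Fact free_coactA x :
  tassoc (tmap free_coact idfun (free_coact x)) = tmap idfun Δ (free_coact x).
Proof.
elim/free_ind: x => [m|c x y hx hy|a x hx|x h hx].
- rewrite free_coact_gen -!tmap_comp.
  have E (t : M ⊗ H) : tmap gen idfun (tassoc (tmap (coact M) idfun t)) =
      tassoc (tmap (free_coact \o gen) (idfun \o idfun) t).
    elim/tens_ind: t => [u v hu hv|n h]; first by rewrite !linearD hu hv.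
    rewrite !tmapE [X in _ = tassoc (X ⊗ₜ _)]free_coact_gen.
    elim/tens_ind: (coact M n) => [u v hu hv|n' h'].
      by rewrite !(tensDl, linearD) hu hv.
    by rewrite !tmapE !tassocE tmapE.
  rewrite -E coactA -tmap_comp; exact: eq_tmap.
- by rewrite !linearP hx hy.
- exact: (bilinear_coassoc (μ := @amul k H) (b := am_act aM) (@comulM k H)
    free_coact_act (coactA a) hx).
- exact: (bilinear_coassoc (μ := @amul k H) (b := am_abs aM) (@comulM k H)
    free_coact_abs hx (comulA h)).
Qed.

Fact free_counit x : tcontr (free_mod M) ε (free_coact x) = x.
Proof.
elim/free_ind: x => [m|c x y hx hy|a x hx|x h hx].
- rewrite free_coact_gen -[m in RHS]coact_counit.
  elim/tens_ind: (coact M m) => [u v hu hv|n h]; first by rewrite !linearD hu hv.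
  by rewrite tmapE !tcontrE linearZ_LR.
- by rewrite !linearP hx hy.
- exact: (bilinear_counit (μ := @amul k H) (b := am_act aM) (@counitM k H)
    free_coact_act (coact_counit a) hx).
- exact: (bilinear_counit (μ := @amul k H) (b := am_abs aM) (@counitM k H)
    free_coact_abs hx (comul_counitr h)).
Qed.

Definition free_comod : comodule H := Comodule free_coactA free_counit.

Fact free_act_colinear :
  @colinear _ _ (tens_comod A free_comod) free_comod (tlift (am_act aM)).
Proof.
exact: (@bilinear_colinear _ _ A free_comod free_comod (am_act aM) free_coact_act).
Qed.

Fact free_abs_colinear :
  @colinear _ _ (tens_comod free_comod reg) free_comod (tlift (am_abs aM)).
Proof.
exact: (@bilinear_colinear _ _ free_comod reg free_comod (am_abs aM) free_coact_abs).
Qed.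

Definition free_lmod : lmodComod A :=
  @LmodComod k H A free_comod (am_act aM) (@am_act1 _ _ _ aM) (@am_actA _ _ _ aM) free_act_colinear.

Definition free_absorb : comod_hom (tens_comod free_lmod reg) free_lmod :=
  @ComodHom k H (tens_comod free_comod reg) free_comod _ free_abs_colinear.

Lemma free_absorbE (x : free_lmod) (h : H) : free_absorb (x ⊗ₜ h) = free_abs x h.
Proof. exact: tliftE. Qed.

Lemma free_absorbing : absorbing free_absorb.
Proof. by move=> x; rewrite free_absorbE free_abs1. Qed.

Definition free_unit : lmc_hom M free_lmod :=
  @LmcHom k H A M free_lmod (@ComodHom k H M free_lmod gen free_coact_gen)
    (@free_gen_act k H A M).

(** Extension of morphisms to the free object. Its colinearity holds by induction,
    every operation of a model being colinear in X and in the free object. *)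
Section Extension.
Variables (X : lmodComod A) (r : comod_hom (tens_comod X reg) X).
Hypothesis r1 : absorbing r.
Variable f : lmc_hom M X.

Let rb (x : X) (h : H) : X := r (x ⊗ₜ h).
Let rb_bilinear : bilinear_for *:%R *:%R rb.
Proof.
split=> [h c x y|x c g h]; rewrite /rb; first by rewrite tensDl tensZl linearP.
by rewrite tensDr tensZr linearP.
Qed.
#[local] HB.instance Definition _ :=
  bilinear_isBilinear.Build k X H X *:%R *:%R rb rb_bilinear.

Let Xam : absmod A := @AbsMod k H A X (lc_act X) rb (@lc_act1 _ _ _ X) (@lc_actA _ _ _ X) r1.
Let fX : {linear M -> Xam} := f.
Let f_am : act_compatible fX := @lmc_hom_act _ _ _ _ _ f.
Let e : {linear free_mod M -> X} := free_evl f_am.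

Let e_absorb x h : e (free_abs x h) = r (e x ⊗ₜ h). Proof. exact: (free_ev_abs f_am). Qed.

Fact free_extend_colinear : @colinear k H free_lmod X e.
Proof.
elim/free_ind => [m|c x y hx hy|a x hx|x h hx].
- rewrite [e _](free_ev_gen f_am) [LHS](comod_hom_colinear f m) [X in tmap e _ X]free_coact_gen.
  rewrite -tmap_comp; apply: eq_tmap => // n; exact/esym/(free_ev_gen f_am).
- by rewrite !linearP hx hy.
- rewrite [e _](free_ev_act f_am) [LHS]lc_act_coact hx
    [coact free_lmod (free_act _ _)]free_coact_act -/(free_coact x).
  elim/tens_ind: (coact A a) => [u v hu hv|b g]; first by rewrite !(tens2Dl, linearD) hu hv.
  elim/tens_ind: (free_coact x) => [u v hu hv|y h]; first by rewrite !(tens2Dr, linearD) hu hv.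
  rewrite !(tmapE, tens2E); congr (_ ⊗ₜ _).
  by rewrite [LHS]tliftE; apply/esym/(free_ev_act f_am).
- rewrite e_absorb comod_hom_colinear coact_tensE hx
    [coact free_lmod (free_abs _ _)]free_coact_abs -/(free_coact x).
  elim/tens_ind: (free_coact x) => [u v hu hv|y g]; first by rewrite !(tens2Dl, linearD) hu hv.
  elim/tens_ind: (Δ h) => [u v hu hv|h' h'']; first by rewrite !(tens2Dr, linearD) hu hv.
  by rewrite !(tmapE, tens2E); congr (_ ⊗ₜ _); apply/esym/e_absorb.
Qed.

Definition free_extend : lmc_hom free_lmod X :=
  @LmcHom k H A free_lmod X (ComodHom free_extend_colinear) (free_ev_act f_am).

Lemma free_extend_gen m : free_extend (free_gen m) = f m.
Proof. exact: (free_ev_gen f_am). Qed.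

Lemma free_extend_abs x h : free_extend (free_abs x h) = r (free_extend x ⊗ₜ h).
Proof. exact: e_absorb. Qed.

End Extension.
End Coaction.
End FreeComodule.

(** * Lifting along surjective stable equivalences *)

Section Braid.
Variables (k : fieldType) (H : hopfAlgType k) (Z : comodule H).
Local Notation Δ := (comul H).
Local Notation reg := (reg_comod H).
Local Notation mull a := ((@amul k H : {bilinear H -> H -> H}) a).

Definition cofree_mull (g : H) (t : Z ⊗ H) : Z ⊗ H := tmap idfun (mull g) t.

Fact cofree_mull_bilinear : bilinear_for *:%R *:%R cofree_mull.
Proof.
split=> [t c g h|g c t u]; last exact: linearP.
rewrite /cofree_mull; elim/tens_ind: t => [x y hx hy|z a].
  by rewrite !linearD /= hx hy scalerDr addrACA.
by rewrite !tmapE /= -tensZr -tensDr; congr (_ ⊗ₜ _); apply: linearPl.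
Qed.

HB.instance Definition _ :=
  bilinear_isBilinear.Build k H (Z ⊗ H) (Z ⊗ H) *:%R *:%R cofree_mull cofree_mull_bilinear.

(** g ⊗ z |-> z0 ⊗ g z1, colinear from H ⊗ Z to the cofree comodule on Z. *)
Definition prebraid (g : H) (z : Z) : Z ⊗ H := cofree_mull g (coact Z z).

Fact prebraid_bilinear : bilinear_for *:%R *:%R prebraid.
Proof.
split=> [z c g h|g c z y]; rewrite /prebraid; first exact: linearPl.
by rewrite linearP [LHS](linearPr (cofree_mull)).
Qed.

HB.instance Definition _ :=
  bilinear_isBilinear.Build k H Z (Z ⊗ H) *:%R *:%R prebraid prebraid_bilinear.

Lemma prebraid_coact (g : reg) (z : Z) :
  coact (cofree H Z) (prebraid g z) = tens2 prebraid (@amul k H) (Δ g) (coact Z z).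
Proof.
rewrite coact_cofree /prebraid /cofree_mull.
have E (t : Z ⊗ H) : tassocV (tmap idfun Δ (tmap idfun (mull g) t)) =
    tens2 cofree_mull (@amul k H) (Δ g) (tassocV (tmap idfun Δ t)).
  elim/tens_ind: t => [x y hx hy|y a]; first by rewrite !linearD hx hy tens2Dr.
  rewrite !tmapE [Δ (amul g a)]comulM.
  elim/tens_ind: (Δ g) => [u v hu hv|b b']; first by rewrite !(tens2Dl, tensDr, linearD) hu hv.
  elim/tens_ind: (Δ a) => [u v hu hv|c c']; first by rewrite !(tens2Dr, tensDr, linearD) hu hv.
  by rewrite tens2E !tassocVE tens2E; congr (_ ⊗ₜ _); apply/esym/tmapE.
rewrite E -coactA tassocK.
elim/tens_ind: (Δ g) => [u v hu hv|b b']; first by rewrite !tens2Dl hu hv.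
elim/tens_ind: (coact Z z) => [u v hu hv|y c]; first by rewrite !(tens2Dr, linearD) hu hv.
by rewrite tmapE !tens2E.
Qed.

(** g ⊗ z |-> z0 ⊗ S(z1) g z2. It lets X ⊗ Z inherit an absorbing map from X: absorb
    on the right of Z what should be absorbed between X and Z. *)
Definition braid : comod_hom (tens_comod reg Z) (tens_comod Z reg) :=
  comod_comp (twist Z)
    (ComodHom (@bilinear_colinear _ _ reg Z (cofree H Z) prebraid prebraid_coact)).

Lemma braid1 (z : Z) : braid ((1 : H) ⊗ₜ z) = z ⊗ₜ 1.
Proof.
rewrite [LHS](_ : _ = twist Z (tlift prebraid ((1 : H) ⊗ₜ z))) // tliftE -twist_coact.
congr (twist Z _); rewrite /prebraid /cofree_mull -[RHS]tmap_id.
by apply: eq_tmap => // a; apply: mul1r.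
Qed.

End Braid.

(** The kernel of a morphism of LMod_A(M^H) with a section s that is colinear but
    in general not A-linear; x |-> x - s (f x) is a colinear retraction on it. *)
Section SplitKernel.
Variables (k : fieldType) (H : hopfAlgType k) (A : comodAlg H).
Variables (L N : lmodComod A) (f : lmc_hom L N) (s : comod_hom N L).
Hypothesis sK : cancel s f.

Fact section_pinv x : f (s (f x)) = f x. Proof. exact: sK. Qed.

Definition splitker : lmodComod A := @kerc k H A L N f s section_pinv.
Definition splitker_inc : lmc_hom splitker L := @kerc_inc k H A L N f s section_pinv.

Lemma splitker_inc_inj : injective splitker_inc.
Proof. exact: ker_inc_inj. Qed.

Lemma splitker_inc0 x : f (splitker_inc x) = 0.
Proof. exact: ker_incP. Qed.

Let r : {linear L -> splitker} := ker_retr section_pinv.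

Let r_inc x : splitker_inc (r x) = x - s (f x).
Proof. exact: ker_inc_retr. Qed.

Fact splitker_retr_colinear : @colinear k H L splitker r.
Proof.
move=> x; pose p : {linear L -> L} := idfun \- (s \o f).
have p_col : colinear p.
  apply: (@comod_sum_colinear _ _ _ _ 1 (-1) (comod_id L) (comod_comp s f)) => y.
  by rewrite scale1r scaleN1r.
rewrite [LHS](_ : _ = tmap r idfun (coact L (p x))); last first.
  by rewrite -[p x]r_inc.
rewrite p_col -tmap_comp; apply: eq_tmap => // y.
apply: splitker_inc_inj; rewrite [splitker_inc _]r_inc r_inc.
by rewrite /= linearB /= sK subrr linear0 subr0.
Qed.

Definition splitker_retr : comod_hom L splitker := ComodHom splitker_retr_colinear.

Lemma splitker_inc_retr x : splitker_inc (splitker_retr x) = x - s (f x).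
Proof. exact: r_inc. Qed.

Lemma splitker_incK : cancel splitker_inc splitker_retr.
Proof.
move=> x; apply: splitker_inc_inj.
by rewrite splitker_inc_retr splitker_inc0 linear0 subr0.
Qed.

Lemma splitker_retr_section n : splitker_retr (s n) = 0.
Proof. by apply: splitker_inc_inj; rewrite splitker_inc_retr sK subrr linear0. Qed.

End SplitKernel.

(** Let aM be the free absorbing module on M. A morphism φ : aM ⊗ Z -> N killing
    M ⊗ Z lifts to h = s φ + κ, with κ : aM ⊗ Z -> K = ker f defined recursively by
      κ (m ⊗ z) = 0,
      κ (a x ⊗ z) = a κ (x ⊗ z) + (a s (φ (x ⊗ z)) - s (a φ (x ⊗ z))),
      κ (x g ⊗ z) = r (κ (x ⊗ z0) ⊗ S(z1) g z2).
    The second equation makes h A-linear although s is not, the third one makes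
    κ colinear and is possible because K is injective. *)
Section Lifting.
Variables (k : fieldType) (H : hopfAlgType k) (A : comodAlg H).
Local Notation reg := (reg_comod H).
Variables (M : lmodComod A) (Z : comodule H).
Variables (L N : lmodComod A) (f : lmc_hom L N) (s : comod_hom N L).
Hypothesis sK : cancel s f.
Local Notation K := (splitker sK).
Local Notation aM := (free_lmod M).
Local Notation inc := (splitker_inc sK).
Local Notation retr := (splitker_retr sK).
Variables (r : comod_hom (tens_comod K reg) K) (φ : comod_hom (tens_comod aM Z) N).
Hypothesis r1 : absorbing r.
Hypothesis φ_act : forall a x z, φ (free_act a x ⊗ₜ z) = lc_act N a (φ (x ⊗ₜ z)).
Hypothesis φ_gen : forall m z, φ (free_gen m ⊗ₜ z) = 0.

Let tensl (U V : lmodType k) (u : U) : {linear V -> U ⊗ V} := (tens : {bilinear U -> V -> U ⊗ V}) u.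

Let defect_lin (a : A) : {linear aM ⊗ Z -> K} := retr \o lc_act L a \o s \o φ.
Let defect (a : A) (t : aM ⊗ Z) : K := defect_lin a t.

(* The recursion for κ refers to x itself, hence the pairs (x, κ (x ⊗ -)). *)
Let D : lmodType k := (free_mod M * linmap Z K)%type.

Let dact (a : A) (p : D) : D :=
  (free_act a p.1, linmap_of (lc_act K a \o p.2) + linmap_of (defect_lin a \o tensl Z p.1)).
Let dabs (p : D) (h : H) : D :=
  (free_abs p.1 h, linmap_of (r \o tmap (linmap_lin p.2) idfun \o braid Z \o tensl Z h)).

Let dact2 a p z :
  (dact a p).2 z = lc_act K a (p.2 z) + retr (lc_act L a (s (φ (p.1 ⊗ₜ z)))).
Proof. by []. Qed.

Let dabs2 p h z :
  (dabs p h).2 z = r (tmap (linmap_lin p.2) idfun (braid Z (h ⊗ₜ z))).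
Proof. by []. Qed.

Let DlinE c (p q : D) z : (c *: p + q).2 z = c *: p.2 z + q.2 z.
Proof. by []. Qed.

Let dact_bilinear : bilinear_for *:%R *:%R dact.
Proof.
split=> [p c a b|a c p q]; apply: injective_projections;
  [exact: (linearPl free_act) | apply: linmapP => z
  |exact: (linearPr free_act) | apply: linmapP => z].
- rewrite DlinE !dact2.
  rewrite (linearPl (lc_act K)) (linearPl (lc_act L)) linearP scalerDr.
  exact: addrACA.
- rewrite DlinE !dact2 DlinE (linearPr (lc_act K)) [(c *: p + q).1]/(c *: p.1 + q.1).
  rewrite tensDl tensZl linearP /= [s _]linearP /= (linearPr (lc_act L)) linearP scalerDr.
  exact: addrACA.
Qed.
#[local] HB.instance Definition _ :=
  bilinear_isBilinear.Build k A D D *:%R *:%R dact dact_bilinear.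

Let dabs_bilinear : bilinear_for *:%R *:%R dabs.
Proof.
split=> [h c p q|p c g h]; apply: injective_projections;
  [exact: (linearPl free_abs) | apply: linmapP => z
  |exact: (linearPr free_abs) | apply: linmapP => z].
- rewrite DlinE !dabs2.
  elim/tens_ind: (braid Z _) => [t u ht hu|y b].
    by rewrite !linearD ht hu addrACA.
  by rewrite !tmapE -linearP -tensZl -tensDl.
- by rewrite DlinE !dabs2 tensDl tensZl !linearP.
Qed.
#[local] HB.instance Definition _ :=
  bilinear_isBilinear.Build k D H D *:%R *:%R dabs dabs_bilinear.

Let dact1 p : dact (ca_one A) p = p.
Proof.
apply: injective_projections; first exact: free_act1.
apply: linmapP => z; rewrite dact2 !lc_act1 splitker_retr_section.
exact: addr0.
Qed.

Let dactA a b p : dact a (dact b p) = dact (ca_mul A a b) p.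
Proof.
apply: injective_projections; first exact: free_actA.
apply: linmapP => z; rewrite !dact2 (linearDr (lc_act K)) lc_actA -addrA; congr (_ + _).
apply: (@splitker_inc_inj _ _ _ _ _ _ _ sK).
rewrite linearD lmc_hom_act !splitker_inc_retr !lmc_hom_act !sK (linearBr (lc_act L)) lc_actA.
by rewrite φ_act addrA subrK lc_actA.
Qed.

Let dabs1 p : dabs p 1 = p.
Proof.
apply: injective_projections; first exact: free_abs1.
by apply: linmapP => z; rewrite dabs2 braid1 tmapE r1.
Qed.

Let Dam : absmod A := AbsMod dact1 dactA dabs1.

Let g_fun (m : M) : D := (free_gen m, 0).
Let g_linear : linear g_fun.
Proof.
move=> c m n; apply: injective_projections; first exact: linearP.
by apply: linmapP => z; rewrite DlinE scaler0 addr0.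
Qed.
Let g : {linear M -> Dam} := HB.pack g_fun (GRing.isLinear.Build k M D *:%R g_fun g_linear).

Let g_am : act_compatible g.
Proof.
move=> a m; apply: injective_projections; first exact: free_gen_act.
by apply: linmapP => z; rewrite [RHS]dact2 φ_gen !linear0 addr0.
Qed.

Let e : {linear free_mod M -> Dam} := free_evl g_am.

(* The first component is a morphism of models fixing the generators. *)
Let e1 x : (e x).1 = x.
Proof.
elim/free_ind: x => [m|c x y hx hy|a x hx|x h hx].
- by rewrite [e _](free_ev_gen g_am).
- by rewrite linearP -{2}hx -{2}hy.
- by rewrite [e _](free_ev_act g_am) -{2}hx.
- by rewrite [e _](free_ev_abs g_am) -{2}hx.
Qed.

Let κ (x : free_mod M) (z : Z) : K := (e x).2 z.

Let κ_gen m z : κ (free_gen m) z = 0.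
Proof. by rewrite /κ [e _](free_ev_gen g_am). Qed.

Let κ_act a x z :
  κ (free_act a x) z = lc_act K a (κ x z) + retr (lc_act L a (s (φ (x ⊗ₜ z)))).
Proof. by rewrite /κ [e _](free_ev_act g_am) -{3}[x]e1. Qed.

Let κ_abs x h z :
  κ (free_abs x h) z = r (tmap (linmap_lin (e x).2) idfun (braid Z (h ⊗ₜ z))).
Proof. by rewrite /κ [e _](free_ev_abs g_am). Qed.

Let κ_bilinear : bilinear_for *:%R *:%R κ.
Proof. by split=> [z c x y|x c z y]; rewrite /κ linearP. Qed.
#[local] HB.instance Definition _ :=
  bilinear_isBilinear.Build k (free_mod M) Z K *:%R *:%R κ κ_bilinear.

Let defect_bilinear : bilinear_for *:%R *:%R defect.
Proof.
split=> [t c a b|a c t u]; rewrite /defect /=.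
  by rewrite (linearPl (lc_act L)) linearP.
by rewrite linearP /= [s _]linearP /= (linearPr (lc_act L)) linearP.
Qed.
#[local] HB.instance Definition _ :=
  bilinear_isBilinear.Build k A (aM ⊗ Z) K *:%R *:%R defect defect_bilinear.

Let apply_fst (x : free_mod M) (t : Z ⊗ H) : K ⊗ H := tmap (linmap_lin (e x).2) idfun t.

Let apply_fstE x z h : apply_fst x (z ⊗ₜ h) = κ x z ⊗ₜ h.
Proof. exact: tmapE. Qed.

Let apply_fst_bilinear : bilinear_for *:%R *:%R apply_fst.
Proof.
split=> [t c x y|x c t u]; last exact: linearP.
have Dr v t' u : apply_fst v (t' + u) = apply_fst v t' + apply_fst v u by exact: linearD.
elim/tens_ind: t => [t u ht hu|z h]; first by rewrite !Dr ht hu /= scalerDr addrACA.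
rewrite !apply_fstE /κ linearP DlinE /=; exact: linearPl.
Qed.
#[local] HB.instance Definition _ :=
  bilinear_isBilinear.Build k (free_mod M) (Z ⊗ H) (K ⊗ H) *:%R *:%R apply_fst apply_fst_bilinear.

Let mulA : forall x y z : H, amul x (amul y z) = amul (amul x y) z.
Proof. exact: mulrA. Qed.

Let colinear_at (x : free_mod M) := forall z,
  coact K (κ x z) = tens2 κ (@amul k H) (coact aM x) (coact Z z).

Let colinear_gen m : colinear_at (free_gen m).
Proof.
move=> z; rewrite κ_gen linear0 [coact aM _]free_coact_gen.
elim/tens_ind: (coact M m) => [t u ht hu|n h].
  by rewrite linearD tens2Dl -ht -hu addr0.
rewrite tmapE; elim/tens_ind: (coact Z z) => [t u ht hu|y g'].
  by rewrite tens2Dr -ht -hu addr0.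
by rewrite tens2E [X in X ⊗ₜ _]κ_gen (linear0l tens).
Qed.

Let colinear_act a x : colinear_at x -> colinear_at (free_act a x).
Proof.
move=> hx z; rewrite κ_act linearD comod_hom_colinear !lc_act_coact hx.
rewrite comod_hom_colinear comod_hom_colinear coact_tensE.
have E1 (u : A ⊗ H) t : tmap (tlift (lc_act K)) idfun (tens2 tens (@amul k H) u t) =
    tens2 (lc_act K) (@amul k H) u t.
  by apply: tmap_tens2 => b y; apply: tliftE.
have E2 (u : A ⊗ H) t : tmap (tlift (lc_act aM)) idfun (tens2 tens (@amul k H) u t) =
    tens2 (lc_act aM) (@amul k H) u t.
  by apply: tmap_tens2 => b y; apply: tliftE.
have E3 (u : A ⊗ H) t : tmap retr idfun (tmap (tlift (lc_act L)) idfun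
     (tens2 tens (@amul k H) u (tmap s idfun (tmap φ idfun t)))) = tens2 defect (@amul k H) u t.
  elim/tens_ind: t => [t t' ht ht'|t h]; first by rewrite !(tens2Dr, linearD) ht ht'.
  elim/tens_ind: u => [u u' hu hu'|b h']; first by rewrite !(tens2Dl, linearD) hu hu'.
  rewrite !(tens2E, tmapE); congr (retr _ ⊗ₜ _); exact: tliftE.
rewrite E1 E2 E3; apply/esym/tens2A_add => [b y z'|]; last exact: mulA.
exact: κ_act.
Qed.

Let apply_fst_coact x : colinear_at x -> forall t,
  coact (tens_comod K reg) (apply_fst x t) =
  tens2 apply_fst (@amul k H) (coact aM x) (coact (tens_comod Z reg) t).
Proof.
move=> hx; elim/tens_ind => [t u ht hu|z h].
  by rewrite (linearDr apply_fst) !linearD tens2Dr ht hu.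
rewrite apply_fstE !coact_tensE hx; apply/esym/tens2A => [y z' h'|]; last exact: mulA.
exact: apply_fstE.
Qed.

Let abs_fst (x : aM) (t : H ⊗ Z) : K := r (apply_fst x (braid Z t)).

Let abs_fst_bilinear : bilinear_for *:%R *:%R abs_fst.
Proof.
split=> [t c x y|x c t u]; rewrite /abs_fst.
  by rewrite (linearPl apply_fst) linearP.
by rewrite linearP /= (linearPr apply_fst) linearP.
Qed.
#[local] HB.instance Definition _ :=
  bilinear_isBilinear.Build k aM (H ⊗ Z) K *:%R *:%R abs_fst abs_fst_bilinear.

Let colinear_abs x h : colinear_at x -> colinear_at (free_abs x h).
Proof.
move=> hx z; rewrite [κ _ _](κ_abs x h z).
rewrite comod_hom_colinear [coact _ _](apply_fst_coact hx) comod_hom_colinear coact_tensE.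
have E (v : aM ⊗ H) t : tmap r idfun (tens2 apply_fst (@amul k H) v (tmap (braid Z) idfun t)) =
    tens2 abs_fst (@amul k H) v t.
  elim/tens_ind: v => [u u' hu hu'|y a]; first by rewrite !(tens2Dl, linearD) hu hu'.
  elim/tens_ind: t => [u u' hu hu'|t b]; first by rewrite !(tens2Dr, linearD) hu hu'.
  by rewrite !(tens2E, tmapE).
rewrite E [coact aM (free_abs _ _)]free_coact_abs.
apply: tens2A => [y g' z'|]; last exact: mulA.
exact/esym/κ_abs.
Qed.

Let colinear_κ x : colinear_at x.
Proof.
elim/free_ind: x => [m|c x y hx hy|a x hx|x h hx].
- exact: colinear_gen.
- move=> z; have -> : κ (c *: x + y) z = c *: κ x z + κ y z by exact: (linearPl κ).
  by rewrite !linearP hx hy tens2Dl tens2Zl.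
- exact: colinear_act.
- exact: colinear_abs.
Qed.

Let κh : comod_hom (tens_comod aM Z) K :=
  ComodHom (@bilinear_colinear _ _ aM Z K κ colinear_κ).

Let κhE x z : κh (x ⊗ₜ z) = κ x z. Proof. exact: tliftE. Qed.

Let lift : {linear aM ⊗ Z -> L} := (s \o φ) \+ (inc \o κh).

Let liftE x z : lift (x ⊗ₜ z) = s (φ (x ⊗ₜ z)) + inc (κ x z).
Proof. by rewrite -κhE. Qed.

Let lift_section t : f (lift t) = φ t.
Proof.
rewrite [lift t](_ : _ = s (φ t) + inc (κh t)) // linearD sK.
by rewrite (@splitker_inc0 _ _ _ _ _ _ _ sK) addr0.
Qed.

Let lift_colinear : @colinear k H (tens_comod aM Z) L lift.
Proof.
apply: (@comod_sum_colinear _ _ _ _ 1 1 (comod_comp s φ) (comod_comp inc κh)) => x.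
by rewrite !scale1r.
Qed.

Lemma free_lift_of_section : exists h : comod_hom (tens_comod aM Z) L,
  [/\ forall t, f (h t) = φ t,
      forall a x z, h (free_act a x ⊗ₜ z) = lc_act L a (h (x ⊗ₜ z))
    & forall m z, h (free_gen m ⊗ₜ z) = 0].
Proof.
exists (ComodHom lift_colinear); split=> [|a x z|m z]; first exact: lift_section.
  rewrite [LHS]liftE [X in lc_act _ _ X]liftE κ_act φ_act linearD lmc_hom_act.
  rewrite splitker_inc_retr lmc_hom_act sK (linearDr (lc_act L)).
  by rewrite addrCA addrC; congr (_ + _); rewrite addrC subrK.
by rewrite [LHS]liftE κ_gen φ_gen !linear0 addr0.
Qed.

End Lifting.

(** * Subcomodules and cokernels *)

Section SubComodule.
Variables (k : fieldType) (H : hopfAlgType k) (X : comodule H) (K : lmodType k).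
Variables (i : {linear K -> X}) (r : {linear X -> K}).
Hypothesis ir : cancel i r.
Hypothesis stable : forall y, tmap (i \o r) idfun (coact X (i y)) = coact X (i y).
Local Notation Δ := (comul H).

Definition sub_coact : {linear K -> K ⊗ H} := tmap r idfun \o coact X \o i.

Lemma sub_coactE y : tmap i idfun (sub_coact y) = coact X (i y).
Proof.
rewrite [sub_coact y](_ : _ = tmap r idfun (coact X (i y))) // -tmap_comp -[RHS]stable.
exact: eq_tmap.
Qed.

Fact sub_coactA y :
  tassoc (tmap sub_coact idfun (sub_coact y)) = tmap idfun Δ (sub_coact y).
Proof.
have inj : injective (tmap i (idfun : {linear H ⊗ H -> H ⊗ H})).
  apply: (@can_inj _ _ _ (tmap r idfun)) => t.
  by rewrite -tmap_comp -[RHS]tmap_id; apply: eq_tmap => // z; apply: ir.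
apply: inj.
have E (t : K ⊗ H) : tmap i idfun (tassoc (tmap sub_coact idfun t)) =
    tassoc (tmap (coact X) idfun (tmap i idfun t)).
  elim/tens_ind: t => [u v hu hv|z h]; first by rewrite !linearD hu hv.
  rewrite !tmapE -sub_coactE; elim/tens_ind: (sub_coact z) => [u v hu hv|w g].
    by rewrite !(tensDl, linearD) hu hv.
  by rewrite ?tmapE ?tassocE ?tmapE ?tassocE ?tmapE.
rewrite E sub_coactE coactA -sub_coactE -!tmap_comp; exact: eq_tmap.
Qed.

Fact sub_counit y : tcontr K (counit H) (sub_coact y) = y.
Proof.
apply: (can_inj ir); rewrite -[RHS]coact_counit -sub_coactE.
elim/tens_ind: (sub_coact y) => [u v hu hv|z h]; first by rewrite !linearD hu hv.
by rewrite tmapE !tcontrE linearZ_LR.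
Qed.

Definition sub_comod : comodule H := Comodule sub_coactA sub_counit.

Definition sub_inc : comod_hom sub_comod X :=
  @ComodHom k H sub_comod X i (fun y => esym (sub_coactE y)).

End SubComodule.

(** The cokernel of a morphism g with an A-linear retraction t, realized on the
    kernel of t; the coaction is the one transported from X / g(M), for which
    ker t need not be a subcomodule of X. *)
Section Cokernel.
Variables (k : fieldType) (H : hopfAlgType k) (A : comodAlg H).
Variables (M X : lmodComod A) (g : lmc_hom M X) (t : {linear X -> M}).
Hypotheses (gt : cancel g t) (t_act : act_linear t).
Local Notation Δ := (comul H).

Fact cok_pinv x : t (g (t x)) = t x. Proof. exact: gt. Qed.

Local Notation Q := (ker t).
Let p : {linear X -> Q} := ker_retr cok_pinv.
Let j : {linear Q -> X} := @ker_inc k X M t.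

Let jp x : j (p x) = x - g (t x). Proof. exact: ker_inc_retr. Qed.
Let pj : cancel j p. Proof. exact: ker_incK. Qed.
Let pg m : p (g m) = 0.
Proof. by apply: ker_inc_inj; rewrite [LHS]jp gt subrr linear0. Qed.
Let tj y : t (j y) = 0. Proof. exact: ker_incP. Qed.

Let cok_coact : {linear Q -> Q ⊗ H} := tmap p idfun \o coact X \o j.

Let cok_coactE x : cok_coact (p x) = tmap p idfun (coact X x).
Proof.
rewrite [LHS](_ : _ = tmap p idfun (coact X (j (p x)))) // jp !linearB.
rewrite -[RHS]subr0; congr (_ - _); rewrite comod_hom_colinear.
elim/tens_ind: (coact M _) => [u v hu hv|m h]; first by rewrite !linearD hu hv addr0.
by rewrite !tmapE pg (linear0l tens).
Qed.

Fact cok_coactA y :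
  tassoc (tmap cok_coact idfun (cok_coact y)) = tmap idfun Δ (cok_coact y).
Proof.
rewrite -[y]pj cok_coactE.
have E (u : X ⊗ H) : tassoc (tmap cok_coact idfun (tmap p idfun u)) =
    tmap p idfun (tassoc (tmap (coact X) idfun u)).
  elim/tens_ind: u => [u v hu hv|x h]; first by rewrite !linearD hu hv.
  rewrite !tmapE cok_coactE; elim/tens_ind: (coact X x) => [u v hu hv|x' h'].
    by rewrite !(tensDl, linearD) hu hv.
  by rewrite ?tmapE ?tassocE ?tmapE ?tassocE ?tmapE.
rewrite E coactA -!tmap_comp; exact: eq_tmap.
Qed.

Fact cok_counit y : tcontr Q (counit H) (cok_coact y) = y.
Proof.
rewrite -[y]pj cok_coactE -[in RHS](coact_counit (j y)).
elim/tens_ind: (coact X _) => [u v hu hv|x h]; first by rewrite !linearD hu hv.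
by rewrite tmapE !tcontrE linearZ_LR.
Qed.

Definition cok_comod : comodule H := Comodule cok_coactA cok_counit.

Definition cok_act (a : A) (y : Q) : Q := p (lc_act X a (j y)).

Fact cok_act_bilinear : bilinear_for *:%R *:%R cok_act.
Proof.
split=> [y c a b|a c y z]; rewrite /cok_act.
  by rewrite (linearPl (lc_act X)) linearP.
have -> : j (c *: y + z) = c *: j y + j z by exact: linearP.
by rewrite (linearPr (lc_act X)) linearP.
Qed.

HB.instance Definition _ :=
  bilinear_isBilinear.Build k A Q Q *:%R *:%R cok_act cok_act_bilinear.

Let j_act a y : j (cok_act a y) = lc_act X a (j y).
Proof. by rewrite /cok_act jp t_act tj (linear0r (lc_act M)) linear0 subr0. Qed.

Let p_act a x : p (lc_act X a x) = cok_act a (p x).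
Proof.
by rewrite /cok_act jp (linearBr (lc_act X)) linearB -lmc_hom_act pg subr0.
Qed.

Fact cok_act1 y : cok_act (ca_one A) y = y.
Proof. by rewrite /cok_act lc_act1. Qed.

Fact cok_actA a b y : cok_act a (cok_act b y) = cok_act (ca_mul A a b) y.
Proof. by rewrite {1}/cok_act j_act lc_actA. Qed.

Fact cok_act_coact a y :
  cok_coact (cok_act a y) = tens2 cok_act (@amul k H) (coact A a) (cok_coact y).
Proof.
rewrite -[y]pj -p_act !cok_coactE lc_act_coact.
elim/tens_ind: (coact A a) => [u v hu hv|b h]; first by rewrite !(tens2Dl, linearD) hu hv.
elim/tens_ind: (coact X _) => [u v hu hv|x h']; first by rewrite !(tens2Dr, linearD) hu hv.
rewrite !(tens2E, tmapE); congr (_ ⊗ₜ _); rewrite -[RHS]p_act; congr (p _).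
exact: tliftE.
Qed.

Definition cok : lmodComod A :=
  @LmodComod k H A cok_comod cok_act cok_act1 cok_actA
    (@bilinear_colinear _ _ A cok_comod cok_comod cok_act cok_act_coact).

Definition cok_proj : lmc_hom X cok :=
  @LmcHom k H A X cok (@ComodHom k H X cok p cok_coactE) p_act.

Definition cok_section : {linear cok -> X} := j.

Lemma cok_projK : cancel cok_section cok_proj. Proof. exact: pj. Qed.
Lemma cok_sectionE x : cok_section (cok_proj x) = x - g (t x). Proof. exact: jp. Qed.
Lemma cok_proj0 m : cok_proj (g m) = 0. Proof. exact: pg. Qed.
Lemma cok_section_act a y : cok_section (lc_act cok a y) = lc_act X a (cok_section y).
Proof. exact: j_act. Qed.

Lemma cok_short_exact : short_exact g cok_proj.
Proof.
split; first exact: can_inj gt.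
  move=> x; split=> [x0|[m <-]]; last exact: cok_proj0.
  by exists (t x); apply/esym/eqP; rewrite -subr_eq0 -cok_sectionE x0 linear0.
by move=> y; exists (cok_section y); apply: cok_projK.
Qed.

Lemma cok_act_split : act_split cok_proj.
Proof. by exists cok_section; split; [exact: cok_section_act | exact: cok_projK]. Qed.

Section Descent.
Variables (Y : lmodComod A) (h : lmc_hom X Y).
Hypothesis hg : forall m, h (g m) = 0.

Let d : {linear cok -> Y} := h \o cok_section.

Let d_proj x : d (cok_proj x) = h x.
Proof.
rewrite [LHS](_ : _ = h (cok_section (cok_proj x))) // cok_sectionE.
by rewrite linearB hg subr0.
Qed.

Fact cok_desc_colinear : @colinear k H cok Y d.
Proof.
move=> y; rewrite -[y]cok_projK d_proj comod_hom_colinear comod_hom_colinear -tmap_comp.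
by apply: eq_tmap => // x; rewrite -d_proj.
Qed.

Fact cok_desc_act : act_linear d.
Proof.
move=> a y; rewrite [LHS](_ : _ = h (cok_section (lc_act cok a y))) //.
by rewrite cok_section_act lmc_hom_act.
Qed.

Definition cok_desc : lmc_hom cok Y :=
  @LmcHom k H A cok Y (ComodHom cok_desc_colinear) cok_desc_act.

Lemma cok_desc_proj x : cok_desc (cok_proj x) = h x. Proof. exact: d_proj. Qed.

End Descent.
End Cokernel.

(** * The functorial short exact sequence *)

Section Resolution.
Variables (k : fieldType) (H : hopfAlgType k) (A : comodAlg H).
Local Notation ε := (counit H).
Local Notation reg := (reg_comod H).
Implicit Types M N L P X : lmodComod A.

Lemma free_hom_ext M X (r : comod_hom (tens_comod X reg) X) (u v : lmc_hom (free_lmod M) X) :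
    (forall m, u (free_gen m) = v (free_gen m)) ->
    (forall x h, u (free_abs x h) = r (u x ⊗ₜ h)) ->
    (forall x h, v (free_abs x h) = r (v x ⊗ₜ h)) ->
  u =1 v.
Proof.
move=> uv ur vr; elim/free_ind => [m|c x y hx hy|a x hx|x h hx].
- exact: uv.
- by rewrite !linearP hx hy.
- by rewrite [u _](lmc_hom_act u) [v _](lmc_hom_act v) hx.
- by rewrite ur vr hx.
Qed.

Definition free_map M N (f : lmc_hom M N) : lmc_hom (free_lmod M) (free_lmod N) :=
  free_extend (@free_absorbing _ _ _ N) (hom_comp (free_unit N) f).

Lemma free_map_gen M N (f : lmc_hom M N) m : free_map f (free_gen m) = free_gen (f m).
Proof. exact: free_extend_gen. Qed.

Lemma free_map_abs M N (f : lmc_hom M N) x h :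
  free_map f (free_abs x h) = free_absorb N (free_map f x ⊗ₜ h).
Proof. exact: free_extend_abs. Qed.

Lemma free_map_id M : free_map (hom_id M) =1 id.
Proof.
apply: (free_hom_ext (v := hom_id (free_lmod M)) (r := free_absorb M)) => [m|x h|x h].
- exact: free_map_gen.
- exact: free_map_abs.
- by rewrite free_absorbE.
Qed.

Lemma free_map_comp M N P (g : lmc_hom N P) (f : lmc_hom M N) x :
  free_map (hom_comp g f) x = free_map g (free_map f x).
Proof.
apply: (free_hom_ext (v := hom_comp (free_map g) (free_map f)) (r := free_absorb P)) => [m|y h|y h].
- by rewrite [RHS](_ : _ = free_map g (free_map f (free_gen m))) // !free_map_gen.
- exact: free_map_abs.
- rewrite [LHS](_ : _ = free_map g (free_map f (free_abs y h))) //.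
  by rewrite free_map_abs free_absorbE free_map_abs.
Qed.

Definition free_functor : lmc_functor A := LmcFunctor free_map_id free_map_comp.

(** (m ⊗ h) ⊗ g |-> m ⊗ hg. Extending m |-> m ⊗ 1 to aM -> M ⊗ H and applying the
    counit gives an A-linear retraction of M -> aM. *)
Definition tensH_absorb M : comod_hom (tens_comod (tensH M) reg) (tensH M) :=
  ComodHom (tmulr_colinear (X := M)).

Lemma tensH_absorbing M : absorbing (tensH_absorb M).
Proof.
elim/tens_ind=> [x y hx hy|m h]; first by rewrite tensDl linearD hx hy.
by rewrite [LHS]tmulrE mulr1.
Qed.

Fact tensH_unit_act M : @act_linear _ _ _ M (tensH M) (unit_hom M).
Proof. by move=> a m; rewrite [RHS]tensH_actE. Qed.

Definition tensH_unit M : lmc_hom M (tensH M) :=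
  @LmcHom k H A M (tensH M) (unit_hom M) (@tensH_unit_act M).

Definition free_retr M : {linear free_lmod M -> M} :=
  tcontr M ε \o free_extend (@tensH_absorbing M) (tensH_unit M).

Lemma free_retr_unit M : cancel (free_unit M) (free_retr M).
Proof.
move=> m; pose e := free_extend (@tensH_absorbing M) (tensH_unit M).
rewrite [LHS](_ : _ = tcontr M ε (e (free_gen m))) //.
by rewrite /e free_extend_gen [LHS]tcontrE counit1 scale1r.
Qed.

Lemma free_retr_act M : act_linear (free_retr M).
Proof.
move=> a x; pose e := free_extend (@tensH_absorbing M) (tensH_unit M).
rewrite [LHS](_ : _ = tcontr M ε (e (lc_act _ a x))) // lmc_hom_act.
rewrite [RHS](_ : _ = lc_act M a (tcontr M ε (e x))) //.
elim/tens_ind: (e x) => [u v hu hv|m h].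
  by rewrite [lc_act (tensH M) a _]tensH_actD !linearD hu hv.
by rewrite [lc_act (tensH M) a _]tensH_actE !tcontrE linearZ_LR.
Qed.

Definition pbar M : lmodComod A := cok (@free_retr_unit M) (@free_retr_act M).
Definition pbar_proj M : lmc_hom (free_lmod M) (pbar M) :=
  cok_proj (@free_retr_unit M) (@free_retr_act M).
Definition pbar_section M : {linear pbar M -> free_lmod M} :=
  cok_section (@free_retr_unit M) (@free_retr_act M).

Fact pbar_map_subproof M N (f : lmc_hom M N) m :
  hom_comp (pbar_proj N) (free_map f) (free_unit M m) = 0.
Proof.
rewrite [LHS](_ : _ = pbar_proj N (free_map f (free_gen m))) // free_map_gen.
exact: cok_proj0.
Qed.

Definition pbar_map M N (f : lmc_hom M N) : lmc_hom (pbar M) (pbar N) :=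
  cok_desc (@free_retr_unit M) (@free_retr_act M) (pbar_map_subproof f).

Lemma pbar_map_proj M N (f : lmc_hom M N) x :
  pbar_map f (pbar_proj M x) = pbar_proj N (free_map f x).
Proof. exact: cok_desc_proj. Qed.

Lemma pbar_projK M : cancel (pbar_section M) (pbar_proj M).
Proof. exact: cok_projK. Qed.

Lemma pbar_map_id M : pbar_map (hom_id M) =1 id.
Proof. by move=> y; rewrite -[y]pbar_projK pbar_map_proj free_map_id. Qed.

Lemma pbar_map_comp M N P (g : lmc_hom N P) (f : lmc_hom M N) y :
  pbar_map (hom_comp g f) y = pbar_map g (pbar_map f y).
Proof. by rewrite -[y]pbar_projK !pbar_map_proj free_map_comp. Qed.

Definition pbar_functor : lmc_functor A := LmcFunctor pbar_map_id pbar_map_comp.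

(** * Cofibrancy *)

Section Cofibrancy.
Variable Lam : left_integral H.
Hypothesis Lam_neq0 : exists h, Lam h <> 0.

Lemma free_lift M (Z : comodule H) L N (f : lmc_hom L N)
    (φ : comod_hom (tens_comod (free_lmod M) Z) N) :
    stable_equivalence f -> (forall n, exists l, f l = n) ->
    (forall a x z, φ (free_act a x ⊗ₜ z) = lc_act N a (φ (x ⊗ₜ z))) ->
    (forall m z, φ (free_gen m ⊗ₜ z) = 0) ->
  exists h : comod_hom (tens_comod (free_lmod M) Z) L,
  [/\ forall t, f (h t) = φ t,
      forall a x z, h (free_act a x ⊗ₜ z) = lc_act L a (h (x ⊗ₜ z))
    & forall m z, h (free_gen m ⊗ₜ z) = 0].
Proof.
move=> f_st f_surj φ_act φ_gen.
have [s sK] := stable_equivalence_section Lam_neq0 f_surj f_st.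
have /injective_absorbing[r r1] : injective_comodule (splitker sK).
  apply: (stable_equivalence_kernel f_st (i := splitker_inc sK) (r := splitker_retr sK)).
    exact: splitker_incK.
  exact: splitker_inc0.
exact: (free_lift_of_section r1).
Qed.

(** The hypotheses on π and j present P as (aM / M) ⊗ Z, A acting on the first factor.
    Both p̄M (with Z = k) and its desuspension (with Z = ker Λ') are of this form. *)
Lemma cofibrant_of_presentation M (Z : comodule H) P
    (π : comod_hom (tens_comod (free_lmod M) Z) P) (j : {linear P -> free_lmod M ⊗ Z}) :
    (forall a x z, π (free_act a x ⊗ₜ z) = lc_act P a (π (x ⊗ₜ z))) ->
    (forall m z, π (free_gen m ⊗ₜ z) = 0) -> cancel j π ->
    (forall x z, j (π (x ⊗ₜ z)) = (x - free_gen (free_retr M x)) ⊗ₜ z) ->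
  cofibrant P.
Proof.
move=> π_act π_gen jK jπ L N f f_st f_surj g.
have [||h [hf h_act h_gen]] := free_lift (φ := comod_comp g π) f_st f_surj.
- by move=> a x z; rewrite -lmc_hom_act -π_act.
- by move=> m z; rewrite -[RHS](linear0 g) -(π_gen m z).
have hjπ t : h (j (π t)) = h t.
  elim/tens_ind: t => [u v hu hv|x z]; first by rewrite !linearD hu hv.
  by rewrite jπ tensBl linearB h_gen subr0.
pose d : {linear P -> L} := h \o j.
have d_col : colinear d.
  move=> y; rewrite -[y]jK [d _]hjπ !comod_hom_colinear -tmap_comp.
  by apply: eq_tmap => // t; rewrite -hjπ.
have d_act : act_linear d.
  move=> a y; rewrite -[y]jK [d (π _)]hjπ.
  elim/tens_ind: (j y) => [u v hu hv|x z].
    by rewrite !linearD hu hv.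
  by rewrite -π_act [d _]hjπ h_act.
exists (@LmcHom k H A P L (ComodHom d_col) d_act) => y.
by rewrite -[y in RHS]jK; apply: hf.
Qed.

End Cofibrancy.
End Resolution.

Section Cofibrant.
Variables (k : fieldType) (H : hopfAlgType k) (A : comodAlg H).
Variables (Lam : left_integral H) (Lam_neq0 : exists h, Lam h <> 0).
Variable M : lmodComod A.
Local Notation aM := (free_lmod M).
Local Notation reg := (reg_comod H).

Section Trivial.
Local Notation I := (triv_comod H k^o).

Fact trunit_colinear (X : comodule H) :
  @colinear k H (tens_comod X I) X (@trunit k X).
Proof.
elim/tens_ind=> [x y hx hy|x c]; first by rewrite !linearD hx hy.
have tE (y : X) : @trunit k X (y ⊗ₜ c) = (c : k) *: y by exact: tliftE.
rewrite tE coact_tensE linearZ_LR.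
elim/tens_ind: (coact X x) => [u v hu hv|y h].
  by rewrite scalerDr tens2Dl linearD hu hv.
rewrite tens2E tmapE -tensZl; congr (_ ⊗ₜ _); first by rewrite -tE.
exact/esym/mulr1.
Qed.

Lemma pbar_cofibrant : cofibrant (pbar M).
Proof.
pose π := comod_comp (pbar_proj M) (ComodHom (@trunit_colinear aM)).
pose j : {linear pbar M -> free_mod M ⊗ k^o} := bil_r tens (1 : k^o) \o pbar_section M.
have πE (x : aM) (c : I) : π (x ⊗ₜ c) = (c : k) *: pbar_proj M x.
  by rewrite -linearZ_LR; congr (pbar_proj M _); apply: tliftE.
apply: (cofibrant_of_presentation Lam_neq0 (π := π) (j := j)).
- by move=> a x c; rewrite !πE (linearZr_LR (lc_act _)) -lmc_hom_act.
- by move=> m c; rewrite πE [X in _ *: X]cok_proj0 scaler0.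
- by move=> y; rewrite [LHS](πE (pbar_section M y) 1) scale1r pbar_projK.
- move=> x c; rewrite [LHS](_ : _ = pbar_section M (π (x ⊗ₜ c)) ⊗ₜ 1) // πE.
  rewrite linearZ_LR [X in _ *: X]cok_sectionE tensZl -tensZr.
  by congr (_ ⊗ₜ _); apply: mulr1.
Qed.

End Trivial.

(** Desuspension of p̄M is p̄M ⊗ Z for the subcomodule Z = ker Λ' of H. Here u is a
    linear pseudo-inverse of Λ', so that h |-> h - Λ'(h) u(1) retracts H onto Z. *)
Section Suspension.
Local Notation Λ' := (integralS Lam).
Local Notation P := (pbar M).
Local Notation T := (sigma_inv Lam P).

Let u : {linear k^o -> H} := projT1 (cid (linear_pinv Λ')).
Let uP x : Λ' (u (Λ' x)) = Λ' x.
Proof. exact: (projT2 (cid (linear_pinv Λ'))). Qed.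

Let Z : lmodType k := ker Λ'.
Let iZ : {linear Z -> H} := @ker_inc _ _ _ Λ'.
Let rZ : {linear H -> Z} := ker_retr uP.

Let uE c : u c = (c : k) *: u 1.
Proof. by rewrite -linearZ_LR; congr (u _); apply/esym/mulr1. Qed.

Let iZr h : iZ (rZ h) = h - (Λ' h : k) *: u 1.
Proof. by rewrite -uE; apply: ker_inc_retr. Qed.

(* Δ maps Z to Z ⊗ H, since Λ'(z1) z2 = Λ'(z) 1 = 0. *)
Let iZ_stable y : tmap (iZ \o rZ) idfun (coact reg (iZ y)) = coact reg (iZ y).
Proof.
have E (t : H ⊗ H) : tmap (iZ \o rZ) idfun t = t - u 1 ⊗ₜ tcontl H Λ' t.
  elim/tens_ind: t => [v w hv hw|a b].
    by rewrite !linearD hv hw tensDr opprD addrACA.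
  by rewrite tmapE tcontlE [X in X ⊗ₜ _]iZr tensBl tensZl -tensZr.
rewrite E integralS_colinear.
have -> : Λ' (iZ y) = 0 by exact: ker_incP.
by rewrite scale0r -[0]/(0 : H) (linear0r tens) subr0.
Qed.

Let Zc : comodule H := sub_comod (X := reg) (@ker_incK _ _ _ _ _ uP) iZ_stable.
Let iZc : comod_hom Zc reg := sub_inc (X := reg) (@ker_incK _ _ _ _ _ uP) iZ_stable.

Let θ : comod_hom (tens_comod aM Zc) (tensH P) := comod_tmap (pbar_proj M) iZc.
Let θE x z : θ (x ⊗ₜ z) = pbar_proj M x ⊗ₜ iZ z. Proof. exact: tmapE. Qed.

Let θ0 t : id_integralS Lam P (θ t) = 0.
Proof.
elim/tens_ind: t => [v w hv hw|x z]; first by rewrite !linearD hv hw addr0.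
rewrite θE [LHS]tcontrE.
have -> : Λ' (iZ z) = 0 by exact: ker_incP.
exact: scale0r.
Qed.

Let w := projT1 (cid (id_integralS_pinv Lam P)).
Let wP := projT2 (cid (id_integralS_pinv Lam P)).
Let inc := sigma_inv_inc Lam P.
Let rT : {linear tensH P -> T} := ker_retr wP.
Let inc_rT x : id_integralS Lam P x = 0 -> inc (rT x) = x.
Proof. by move=> x0; rewrite [LHS]ker_inc_retr x0 linear0 subr0. Qed.
Let rT_inc : cancel inc rT. Proof. exact: ker_incK. Qed.

Let πl : {linear aM ⊗ Z -> T} := rT \o θ.
Let incπ t : inc (πl t) = θ t. Proof. by apply: inc_rT; apply: θ0. Qed.

Let π_colinear : @colinear k H (tens_comod aM Zc) T πl.
Proof.
move=> t; apply: (@can_inj _ _ (tmap inc idfun) (tmap rT idfun)) => [y|].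
  by rewrite -tmap_comp -[RHS]tmap_id; apply: eq_tmap => // z; apply: rT_inc.
rewrite -comod_hom_colinear incπ comod_hom_colinear -tmap_comp.
by apply: eq_tmap => // z; rewrite -incπ.
Qed.
Let π : comod_hom (tens_comod aM Zc) T := ComodHom π_colinear.

Let j : {linear T -> free_mod M ⊗ Z} := tmap (pbar_section M) rZ \o inc.

Lemma sigma_inv_pbar_cofibrant : cofibrant T.
Proof.
apply: (cofibrant_of_presentation Lam_neq0 (π := π) (j := j)).
- move=> a x z; apply: sigma_inv_inc_inj; rewrite [LHS]incπ θE.
  rewrite [pbar_proj M _](lmc_hom_act (pbar_proj M) a x).
  rewrite [RHS](_ : _ = lc_act (tensH P) a (inc (πl (x ⊗ₜ z)))); last exact: lmc_hom_act.
  by rewrite incπ θE; apply/esym/tensH_actE.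
- move=> m z; apply: sigma_inv_inc_inj; rewrite [LHS]incπ θE linear0.
  by rewrite [X in X ⊗ₜ _]cok_proj0 (linear0l tens).
- move=> y; apply: sigma_inv_inc_inj; rewrite [LHS]incπ.
  have E (t : P ⊗ H) : θ (tmap (pbar_section M) rZ t) = t - id_integralS Lam P t ⊗ₜ u 1.
    elim/tens_ind: t => [v v' hv hv'|p h].
      by rewrite !linearD hv hv' tensDl opprD addrACA.
    rewrite tmapE θE pbar_projK [id_integralS _ _ _]tcontrE [X in _ ⊗ₜ X]iZr.
    by rewrite (linearBr tens) tensZl; congr (_ - _); apply: tensZr.
  rewrite [LHS]E [id_integralS _ _ _](_ : _ = 0) ?(linear0l tens) ?subr0 //.
  exact: ker_incP.
- move=> x z; rewrite [LHS](_ : _ = tmap (pbar_section M) rZ (inc (πl (x ⊗ₜ z)))) //.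
  rewrite incπ θE tmapE; congr (_ ⊗ₜ _); exact: ker_incK.
Qed.

End Suspension.
End Cofibrant.

Theorem proposition3p6 (k : fieldType) (H : hopfAlgType k)
    (Lam : left_integral H) (Lam_neq0 : exists h : H, Lam h <> 0)
    (A : comodAlg H) :
  exists (a pbar : lmc_functor A)
         (i : forall M : lmodComod A, lmc_hom M (a M))
         (q : forall M : lmodComod A, lmc_hom (a M) (pbar M)),
    (forall (M N : lmodComod A) (f : lmc_hom M N) (m : M),
        fmap a f (i M m) = i N (f m)) /\
    (forall (M N : lmodComod A) (f : lmc_hom M N) (x : a M),
        fmap pbar f (q M x) = q N (fmap a f x)) /\
    (forall M : lmodComod A,
        short_exact (i M) (q M) /\
        act_split (q M) /\
        cofibrant (pbar M) /\
        cofibrant (sigma_inv Lam (pbar M)) /\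
        injective_comodule (a M)).
Proof.
exists (free_functor A), (pbar_functor A), (@free_unit k H A), (@pbar_proj k H A).
split; first by move=> M N f m; apply: free_map_gen.
split; first by move=> M N f x; apply: pbar_map_proj.
move=> M; split; first exact: cok_short_exact.
split; first exact: cok_act_split.
split; first exact: (pbar_cofibrant Lam_neq0).
split; first exact: (sigma_inv_pbar_cofibrant Lam_neq0).
exact: (absorbing_injective (@free_absorbing _ _ _ M)).
Qed.
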